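(* Assume the continuity assumption holds and that the estimators $\hat p_k$ take values in $[0,1]$. Then there is a constant $C>0$, not depending on $n$, $N$, $u$ or the estimators, such that $$\mathbb{E}[\mathcal{R}_{\lambda^*}(\hat g)]-\mathcal{R}_{\lambda^*}(g^*_{\rm fair})\le C\Big(\mathbb{E}\big[\|\hat{\mathbf p}-\mathbf p\|_1\big]+\sum_{s\in\{-1,1\}}\mathbb{E}|\hat\pi_s-\pi_s|+\mathbb{E}[\mathcal{U}(\hat g)]+u\Big),$$ where $\|\hat{\mathbf p}-\mathbf p\|_1=\sum_{k=1}^K|\hat p_k(X,S)-p_k(X,S)|$ with $(X,S)$ a new independent draw (the expectation being over it and the data).
   Context: $(X,S,Y)\sim\mathbb{P}$, $X\in\mathcal{X}\subset\mathbb{R}^d$, $S\in\{-1,1\}$, $Y\in[K]$, $\pi_s=\mathbb{P}(S=s)>0$, $p_k(x,s)=\mathbb{P}(Y=k\mid X=x,S=s)$. Risk $\mathcal{R}(g)=\mathbb{P}(g(X,S)\ne Y)$; unfairness $\mathcal{U}(g)=\max_k|\mathbb{P}(g(X,S)=k\mid S=1)-\mathbb{P}(g(X,S)=k\mid S=-1)|$; fair-risk $\mathcal{R}_\lambda(g)=\mathcal{R}(g)+\sum_k\lambda_k[\mathbb{P}(g(X,S)=k\mid S=1)-\mathbb{P}(g(X,S)=k\mid S=-1)]$. Continuity assumption: for all $k\neq j$ and $s$, $t\mapsto\mathbb{P}(p_k(X,S)-p_j(X,S)\le t\mid S=s)$ is continuous. $\lambda^*$ minimizes $\lambda\mapsto\sum_s\mathbb{E}[\max_k(\pi_sp_k(X,s)-s\lambda_k)\mid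 S=s]$ over $\mathbb{R}^K$, and $g^*_{\rm fair}(x,s)\in\arg\max_k(\pi_sp_k(x,s)-s\lambda^*_k)$ (an optimal exactly fair classifier). Plug-in construction: $\mathcal{D}_n$ is a labeled i.i.d. sample from $\mathbb{P}$ from which estimators $\hat p_k$ are built. Independently, $\mathcal{D}'_N$ consists of $N$ i.i.d. copies of $(X,S)$; $N_s$ is the number with $S=s$, $\hat\pi_s=N_s/N$, and $X^s_1,\dots,X^s_{N_s}$ are the features with $S=s$. Fix $u>0$; $(\zeta^s_{k,i})$ are i.i.d. Uniform$[0,u]$ independent of everything, $\bar p_k(x,s,\zeta)=\hat p_k(x,s)+\zeta$. $\hat\lambda$ minimizes $\lambda\mapsto\sum_s\frac1{N_s}\sum_{i=1}^{N_s}\max_k(\hat\pi_s\bar p_k(X^s_i,s,\zeta^s_{k,i})-s\lambda_k)$. The randomized classifier is $\hat g(x,s)=\arg\max_k(\hat\pi_s\bar p_k(x,s,\zeta_k)-s\hat\lambda_k)$ with fresh i.i.d. Uniform$[0,u]$ perturbations $(\zeta_k)$ at each prediction. $\mathcal{R}_{\lambda^*}(\hat g)$ and $\mathcal{U}(\hat g)$ are computed conditionally on the data and $(\zeta^s_{k,i})$, over a new $(X,S,Y)$ and the fresh perturbations. *)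

(* Defs.v *)
From HB Require Import structures.
From mathcomp Require Import all_boot all_order all_algebra.
From mathcomp Require Import all_classical all_reals all_analysis.

Set Implicit Arguments.
Unset Strict Implicit.
Unset Printing Implicit Defensive.
Import Order.TTheory GRing.Theory Num.Theory numFieldNormedType.Exports.
Local Open Scope ring_scope.

Section Defs.
Variable R : realType.

Definition Ex {dT} {T : measurableType dT} (m : probability T R) (f : T -> R) : R :=
  Rintegral m setT f.

(* expectation of f(Z_1,...,Z_n) for Z_1,...,Z_n i.i.d. with common law given by
   the expectation functional E (iterated integral = integral w.r.t. the
   product law, by Fubini, for the bounded measurable integrands used here) *)
Fixpoint iidE (T : Type) (E : (T -> R) -> R) (n : nat) : (n.-tuple T -> R) -> R :=
  match n return (n.-tuple T -> R) -> R with
  | 0 => fun f => f [tuple]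
  | m.+1 => fun f => E (fun x => @iidE T E m (fun t => f (cons_tuple x t)))
  end.

(* features X in R^d (as d.-tuple R), sensitive attribute S in {-1,1}
   encoded by bool (true <-> S = 1, false <-> S = -1), label Y in 'I_K. *)
Definition sgn (s : bool) : R := if s then 1 else -1.

Definition maxK (K : nat) (k0 : 'I_K) (F : 'I_K -> R) : R :=
  \big[Num.max/F k0]_(k < K) F k.

Definition argmaxK (K : nat) (k0 : 'I_K) (F : 'I_K -> R) : 'I_K :=
  [arg max_(k > k0) F k]%O.

Context (d K : nat).
Local Notation XS := (d.-tuple R * bool)%type.

(* The law P of (X,S,Y): mu is the law of (X,S), p xs k = P(Y = k | (X,S) = xs).
   Expectation of f(X,S,Y) under P: *)
Definition EP (mu : probability XS R) (p : XS -> 'I_K -> R)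
    (f : (XS * 'I_K) -> R) : R :=
  Ex mu (fun xs => \sum_(k < K) p xs k * f (xs, k)).

(* Same, for a labeled observation stored as ((X,S), Y) with Y : nat (Y < K),
   nat carrying its (discrete) measurable structure; used for the sample D_n. *)
Definition EPobs (mu : probability XS R) (p : XS -> 'I_K -> R)
    (f : (XS * nat) -> R) : R :=
  Ex mu (fun xs => \sum_(k < K) p xs k * f (xs, val k)).

Definition pis (mu : probability XS R) (s : bool) : R :=
  fine (mu [set xs | xs.2 = s]%classic).

Definition condE (mu : probability XS R) (s : bool) (f : d.-tuple R -> R) : R :=
  Ex mu (fun xs => (xs.2 == s)%:R * f xs.1) / pis mu s.

Definition cdf_diff (mu : probability XS R) (p : XS -> 'I_K -> R)
    (k j : 'I_K) (s : bool) (t : R) : R :=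
  fine (mu [set xs | xs.2 = s /\ p xs k - p xs j <= t]%classic) / pis mu s.

Definition continuity_assumption (mu : probability XS R) (p : XS -> 'I_K -> R) :=
  forall (k j : 'I_K) (s : bool), k != j -> continuous (cdf_diff mu p k j s).

Definition pop_obj (k0 : 'I_K) (mu : probability XS R) (p : XS -> 'I_K -> R)
    (lam : 'I_K -> R) : R :=
  \sum_(s : bool)
    condE mu s (fun x => maxK k0 (fun k => pis mu s * p (x, s) k - sgn s * lam k)).

Definition gfair (k0 : 'I_K) (mu : probability XS R) (p : XS -> 'I_K -> R)
    (lam : 'I_K -> R) (x : d.-tuple R) (s : bool) : 'I_K :=
  argmaxK k0 (fun k => pis mu s * p (x, s) k - sgn s * lam k).

Definition risk (mu : probability XS R) (p : XS -> 'I_K -> R)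
    (g : d.-tuple R -> bool -> 'I_K) : R :=
  EP mu p (fun w => (g w.1.1 w.1.2 != w.2)%:R).

Definition predP (mu : probability XS R) (g : d.-tuple R -> bool -> 'I_K)
    (k : 'I_K) (s : bool) : R :=
  Ex mu (fun xs => ((g xs.1 xs.2 == k) && (xs.2 == s))%:R) / pis mu s.

Definition fair_risk (mu : probability XS R) (p : XS -> 'I_K -> R)
    (lam : 'I_K -> R) (g : d.-tuple R -> bool -> 'I_K) : R :=
  risk mu p g + \sum_(k < K) lam k * (predP mu g k true - predP mu g k false).

(* randomized classifiers G : X -> S -> [0,u]^K -> [K], where the
   perturbation vector zeta = (zeta_k)_k is drawn fresh, i.i.d. Uniform[0,u] *)
Section Randomized.
Variables (u : R) (hu : 0 < u).

Definition Eunif (f : R -> R) : R := Rintegral (uniform_prob hu) setT f.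

Definition Ezeta (f : K.-tuple R -> R) : R := @iidE _ Eunif K f.

Definition riskR (mu : probability XS R) (p : XS -> 'I_K -> R)
    (G : d.-tuple R -> bool -> K.-tuple R -> 'I_K) : R :=
  Ezeta (fun z => risk mu p (fun x s => G x s z)).

Definition predPR (mu : probability XS R)
    (G : d.-tuple R -> bool -> K.-tuple R -> 'I_K) (k : 'I_K) (s : bool) : R :=
  Ezeta (fun z => predP mu (fun x s => G x s z) k s).

Definition fair_riskR (mu : probability XS R) (p : XS -> 'I_K -> R)
    (lam : 'I_K -> R) (G : d.-tuple R -> bool -> K.-tuple R -> 'I_K) : R :=
  riskR mu p G + \sum_(k < K) lam k * (predPR mu G k true - predPR mu G k false).

Definition unfairR (mu : probability XS R)
    (G : d.-tuple R -> bool -> K.-tuple R -> 'I_K) : R :=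
  \big[Num.max/0]_(k < K) `|predPR mu G k true - predPR mu G k false|.

(* one element: ((X_j, S_j), (zeta_{k,j})_k) *)
Definition Eunl (mu : probability XS R) (f : (XS * K.-tuple R) -> R) : R :=
  Ex mu (fun xs => Ezeta (fun z => f (xs, z))).

End Randomized.

Definition Ncount (N : nat) (smp : N.-tuple (XS * K.-tuple R)) (s : bool) : nat :=
  count (fun w => w.1.2 == s) smp.

Definition pihat (N : nat) (smp : N.-tuple (XS * K.-tuple R)) (s : bool) : R :=
  (Ncount smp s)%:R / N%:R.

Definition emp_obj (k0 : 'I_K) (N : nat) (ph : XS -> 'I_K -> R)
    (smp : N.-tuple (XS * K.-tuple R)) (lam : 'I_K -> R) : R :=
  \sum_(s : bool) ((Ncount smp s)%:R)^-1 *
    \sum_(w <- smp | w.1.2 == s)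
       maxK k0 (fun k => pihat smp s * (ph (w.1.1, s) k + tnth w.2 k) - sgn s * lam k).

Definition ghat (k0 : 'I_K) (N : nat) (ph : XS -> 'I_K -> R)
    (smp : N.-tuple (XS * K.-tuple R)) (lamh : 'I_K -> R)
    (x : d.-tuple R) (s : bool) (z : K.-tuple R) : 'I_K :=
  argmaxK k0 (fun k => pihat smp s * (ph (x, s) k + tnth z k) - sgn s * lamh k).

End Defs.

(* Main.v *)
Require Import Defs.
From HB Require Import structures.
From mathcomp Require Import all_boot all_order all_algebra.
From mathcomp Require Import all_classical all_reals all_analysis.
From mathcomp Require Import measurable_realfun ring lra.
Import Order.TTheory GRing.Theory Num.Theory numFieldNormedType.Exports.
Local Open Scope ring_scope.

(* Writing h_k(x,s) = pi_s p_k(x,s) - s lam_k, the fair-risk of g is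
   1 - sum_s E[h_{g(X,s)}(X,s) | S = s], so at [lamstar] its excess over the
   optimum is sum_s E[h_{gstar} - h_{ghat} | S = s].  Comparing with the empirical
   scores maximized by ghat costs the estimation errors plus
   sum_k (lamstar_k - lamhat_k) (gap_k(ghat) - gap_k(gstar)), where gap_k is the
   difference of the two group-conditional probabilities of predicting k.

   - gap_k(gstar) = 0: moving lamstar by +-t along e_k changes the convex objective
     by at most -+ t gap_k(g_t), g_t being the classifier of the moved parameter,
     and g_t differs from gstar only on near-ties, whose mass vanishes with t by
     continuity.
   - The gaps of ghat sum to 0, so only the oscillation of lamhat matters; it is
     at most 2(1+u) because the objective dominates lam_i - lam_j.
   - lamhat is unconstrained when a group is missing from the sample, but then
     |pihat_s - pi_s| = pi_s for this group, which absorbs the bounded excess. *)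

Set Implicit Arguments.
Unset Strict Implicit.

(** * Bounded measurable functions *)

Section BoundedMeasurable.
Context {R : realType} {dT : measure_display} {T : measurableType dT}.
Implicit Types f g : T -> R.

(** The common class of integrands: it is closed under the algebra used below and under partial
    expectation, and it is integrable for every probability, so that linearity and monotonicity need
    no further side condition. *)
Definition bmfun f : Prop :=
  measurable_fun setT f /\ exists M, forall x, `|f x| <= M.

Lemma bmfun_cst (c : R) : bmfun (fun=> c).
Proof. by split; [exact: measurable_cst | exists `|c|]. Qed.

Lemma bmfunD f g : bmfun f -> bmfun g -> bmfun (fun x => f x + g x).
Proof.
move=> [mf [M fM]] [mg [M' gM]]; split; first exact: measurable_funD.
by exists (M + M') => x; rewrite (le_trans (ler_normD _ _))// lerD.
Qed.

Lemma bmfunM f g : bmfun f -> bmfun g -> bmfun (fun x => f x * g x).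
Proof.
move=> [mf [M fM]] [mg [M' gM]]; split; first exact: measurable_funM.
by exists (M * M') => x; rewrite normrM ler_pM.
Qed.

Lemma bmfunN f : bmfun f -> bmfun (fun x => - f x).
Proof.
move=> [mf [M fM]]; split; first exact: measurableT_comp.
by exists M => x; rewrite normrN.
Qed.

Lemma bmfunB f g : bmfun f -> bmfun g -> bmfun (fun x => f x - g x).
Proof. by move=> bf bg; apply: bmfunD => //; exact: bmfunN. Qed.

Lemma bmfun_norm f : bmfun f -> bmfun (fun x => `|f x|).
Proof.
move=> [mf [M fM]]; split; first exact: measurableT_comp.
by exists M => x; rewrite normr_id.
Qed.

Lemma bmfun_sum (I : Type) (r : seq I) (P : pred I) (F : I -> T -> R) :
  (forall i, bmfun (F i)) -> bmfun (fun x => \sum_(i <- r | P i) F i x).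
Proof.
move=> bF; elim: r => [|i r IH].
  by under eq_fun do rewrite big_nil; exact: bmfun_cst.
under eq_fun do rewrite big_cons.
by case: (P i) => //; exact: bmfunD.
Qed.

Lemma bmfun_bool (b : T -> bool) : measurable_fun setT b ->
  bmfun (fun x => (b x)%:R).
Proof.
move=> mb; split; last by exists 1 => x; case: (b x); rewrite ?normr1// normr0.
rewrite (_ : (fun _ => _) = fun x => if b x then 1 else 0); last first.
  by apply/funext => x; case: (b x).
exact: measurable_fun_ifT.
Qed.

Lemma bmfun_bigmax (I : Type) (r : seq I) (F : I -> T -> R) :
  (forall i, bmfun (F i)) -> bmfun (fun x => \big[Num.max/0]_(i <- r) F i x).
Proof.
move=> bF; elim: r => [|i r [mr [M rM]]].
  by under eq_fun do rewrite big_nil; exact: bmfun_cst.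
have [mi [M' iM]] := bF i.
under eq_fun do rewrite big_cons; split; first exact: measurable_maxr.
exists (Num.max M' M) => x; rewrite le_max.
by case: (leP (F i x)) => _; rewrite ?iM ?rM ?orbT.
Qed.

End BoundedMeasurable.

Lemma bmfun_comp {R : realType} d1 d2 (T1 : measurableType d1)
    (T2 : measurableType d2) (f : T2 -> R) (h : T1 -> T2) :
  measurable_fun setT h -> bmfun f -> bmfun (fun x => f (h x)).
Proof.
move=> mh [mf [M fM]]; split; last by exists M => x.
exact: measurableT_comp.
Qed.

(* The properties of an expectation functional, concentrated on [S], that are
   stable under iteration; [mean_param] is what makes iterated expectations
   meaningful. *)
Record mean_on {R : realType} d (T : measurableType d) (S : T -> Prop)
    (E : (T -> R) -> R) : Prop := MeanOn {
  mean_lin : forall a f g, bmfun f -> bmfun g ->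
    E (fun x => a * f x + g x) = a * E f + E g ;
  mean_cst : forall c, E (fun=> c) = c ;
  mean_le : forall f g, bmfun f -> bmfun g -> (forall x, S x -> f x <= g x) ->
    E f <= E g ;
  mean_param : forall d' (A : measurableType d') (f : A * T -> R), bmfun f ->
    measurable_fun setT (fun a => E (fun x => f (a, x))) }.
Arguments mean_on {R d T} S E.

(** * Calculus of expectation functionals and their iteration *)

Section MeanTheory.
Context {R : realType} {dT : measure_display} {T : measurableType dT}.
Context {S : T -> Prop} {E : (T -> R) -> R} (mE : mean_on S E).
Implicit Types f g : T -> R.

Lemma meanD f g : bmfun f -> bmfun g -> E (fun x => f x + g x) = E f + E g.
Proof.
move=> bf bg; rewrite -[E f]mul1r -(mean_lin mE)//; congr E.
by apply/funext => x; rewrite mul1r.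
Qed.

Lemma meanZ a f : bmfun f -> E (fun x => a * f x) = a * E f.
Proof.
move=> bf; rewrite -[RHS]addr0 -[X in _ = _ + X](mean_cst mE 0) -(mean_lin mE)//;
  last exact: bmfun_cst.
by congr E; apply/funext => x; rewrite addr0.
Qed.

Lemma meanB f g : bmfun f -> bmfun g -> E (fun x => f x - g x) = E f - E g.
Proof.
move=> bf bg; rewrite meanD//; last exact: bmfunN.
congr (_ + _); rewrite -[RHS]mulN1r -meanZ//; congr E.
by apply/funext => x; rewrite mulN1r.
Qed.

Lemma mean_sum (I : Type) (r : seq I) (P : pred I) (F : I -> T -> R) :
  (forall i, bmfun (F i)) ->
  E (fun x => \sum_(i <- r | P i) F i x) = \sum_(i <- r | P i) E (F i).
Proof.
move=> bF; elim: r => [|i r IH].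
  rewrite big_nil -[RHS](mean_cst mE); congr E.
  by apply/funext => x; rewrite big_nil.
rewrite big_cons; under eq_fun do rewrite big_cons.
by case: (P i) => //; rewrite meanD ?IH//; exact: bmfun_sum.
Qed.

Lemma mean_ge c f : bmfun f -> (forall x, S x -> c <= f x) -> c <= E f.
Proof.
move=> bf cf; rewrite -(mean_cst mE c); apply: (mean_le mE) => //.
exact: bmfun_cst.
Qed.

Lemma mean_le_cst c f : bmfun f -> (forall x, S x -> f x <= c) -> E f <= c.
Proof.
move=> bf cf; rewrite -[leRHS](mean_cst mE c); apply: (mean_le mE) => //.
exact: bmfun_cst.
Qed.

(** A joint bound of [f] bounds every section, hence every partial expectation. This is what keeps
    the class closed when expectations are iterated. *)
Lemma bmfun_mean d' (A : measurableType d') (f : A -> T -> R) :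
  bmfun (fun z : A * T => f z.1 z.2) -> bmfun (fun a => E (f a)).
Proof.
move=> bf; split; first exact: (mean_param mE bf).
have [mf [M fM]] := bf; exists M => a.
have bfa : bmfun (f a).
  exact: (bmfun_comp (pair1_measurable a) bf).
have fM' x : - M <= f a x <= M by rewrite -ler_norml (fM (a, x)).
rewrite ler_norml mean_le_cst ?mean_ge// => x _.
  by case/andP: (fM' x).
by case/andP: (fM' x).
Qed.

End MeanTheory.

(** By [bmfun_mean] the inner expectation is again an admissible integrand for the outer one, so
    each property is used twice. For measurability in a parameter, the outer variable first joins
    the parameter of the inner expectation. *)
Lemma mean_nested {R : realType} d1 d2 (T1 : measurableType d1)
    (T2 : measurableType d2) S1 S2 (E1 : (T1 -> R) -> R) (E2 : (T2 -> R) -> R) :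
  mean_on S1 E1 -> mean_on S2 E2 ->
  mean_on (fun z : T1 * T2 => S1 z.1 /\ S2 z.2)
    (fun f => E1 (fun x => E2 (fun y => f (x, y)))).
Proof.
move=> m1 m2.
have sec (f : T1 * T2 -> R) x : bmfun f -> bmfun (fun y => f (x, y)).
  exact: (bmfun_comp (pair1_measurable x)).
have par (f : T1 * T2 -> R) : bmfun f -> bmfun (fun x => E2 (fun y => f (x, y))).
  by move=> bf; apply: (bmfun_mean m2); under eq_fun do rewrite -surjective_pairing.
split=> [a f g bf bg|c|f g bf bg fg|d' A f bf].
- rewrite -(mean_lin m1); [|exact: par..].
  by congr E1; apply/funext => x; rewrite -(mean_lin m2)//; exact: sec.
- by rewrite -[RHS](mean_cst m1); congr E1; apply/funext => x; exact: mean_cst m2 c.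
- apply: (mean_le m1); [exact: par..|move=> x S1x].
  by apply: (mean_le m2); [exact: sec..|move=> y S2y; exact: fg].
- apply: (mean_param m1 (f := fun z : A * T1 => E2 (fun y => f (z.1, (z.2, y))))).
  apply: (bmfun_mean m2 (f := fun (z : A * T1) y => f (z.1, (z.2, y)))).
  apply: (bmfun_comp _ bf).
  by repeat apply: measurable_fun_pair; repeat apply: measurableT_comp.
Qed.

(** Induction on [n]: through [cons_tuple], one more draw is a nested expectation over a head and a
    tail. *)
Lemma mean_iidE {R : realType} d (T : measurableType d) S (E : (T -> R) -> R) n :
  mean_on S E -> mean_on (fun t : n.-tuple T => forall i, S (tnth t i)) (@iidE R T E n).
Proof.
move=> mE; elim: n => [|n IH].
  split=> //= [f g _ _ fg|d' A f bf]; first by apply: fg => -[].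
  apply: (measurableT_comp (f := f)) bf.1 _.
  exact: measurable_fun_pair.
have mcons : measurable_fun setT (fun z : T * n.-tuple T => cons_tuple z.1 z.2).
  exact: measurable_cons.
have m2 := mean_nested mE IH.
have conv (f : n.+1.-tuple T -> R) : bmfun f ->
    bmfun (fun z : T * n.-tuple T => f (cons_tuple z.1 z.2)).
  exact: bmfun_comp.
split=> [a f g bf bg|c|f g bf bg fg|d' A f bf] /=.
- exact: (mean_lin m2 a (conv _ bf) (conv _ bg)).
- exact: (mean_cst m2 c).
- apply: (mean_le m2 (conv _ bf) (conv _ bg)) => -[x t] /= [Sx St].
  by apply: fg => i; case: (unliftP ord0 i) => [j|] ->; rewrite ?tnthS ?tnth0.
- apply: (mean_param m2 (f := fun z => f (z.1, cons_tuple z.2.1 z.2.2))).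
  apply: (bmfun_comp _ bf); apply: measurable_fun_pair => //.
  exact: (measurableT_comp mcons).
Qed.

(** * The concrete expectations: probabilities, perturbations, samples *)

Section MeanProbability.
Context {R : realType} {dT : measure_display} {T : measurableType dT}.
Context (m : probability T R).

Lemma bmfun_integrable (f : T -> R) : bmfun f -> m.-integrable setT (EFin \o f).
Proof.
move=> [mf [M fM]]; apply: measurable_bounded_integrable => //.
  exact: fin_num_fun_lty.
exists M; split; first exact: num_real.
by move=> x Mx y _; rewrite /= (le_trans (fM y))// ltW.
Qed.

Lemma Ex_bool (b : T -> bool) : measurable_fun setT b ->
  Ex m (fun x => (b x)%:R) = fine (m [set x | b x]%classic).
Proof.
set B := [set x | b x]%classic => mb.
have mB : measurable B.
  by rewrite -[B]setTI; exact: (mb measurableT [set true]%classic).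
rewrite -[X in fine (m X)]setIT -integral_indic// /Ex /Rintegral.
congr fine; apply: eq_integral => x _; congr EFin.
rewrite indicE; case: (boolP (b x)) => bx; first by rewrite mem_set.
by rewrite memNset//; exact/negP.
Qed.

Let bmfun_Ex (A : set T) : measurable A -> bmfun (\1_A : T -> R).
Proof.
move=> mA; split; first exact: measurable_indic.
by exists 1 => x; rewrite indicE; case: (x \in A); rewrite ?normr1 ?normr0.
Qed.

Let Ex_lin a (f g : T -> R) : bmfun f -> bmfun g ->
  Ex m (fun x => a * f x + g x) = a * Ex m f + Ex m g.
Proof.
move=> bf bg; rewrite /Ex RintegralD ?RintegralZl//; last 3 first.
  exact: bmfun_integrable.
  by apply: bmfun_integrable; apply: bmfunM => //; exact: bmfun_cst.
exact: bmfun_integrable.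
Qed.

Let Ex_cst c : Ex m (fun=> c) = c.
Proof. by rewrite /Ex Rintegral_cst//= probability_setT mulr1. Qed.

Let Ex_param d' (A : measurableType d') (f : A * T -> R) : bmfun f ->
  measurable_fun setT (fun a => Ex m (fun x => f (a, x))).
Proof.
move=> bf; have [mf [M fM]] := bf.
have bfa a : bmfun (fun x => f (a, x)).
  exact: (bmfun_comp (pair1_measurable a) bf).
(* Tonelli's measurability statement is about nonnegative integrands, so [f] is lifted by its bound
   [M] and the constant is subtracted afterwards. *)
have -> : (fun a => Ex m (fun x => f (a, x))) =
    (fun a => fine (\int[m]_x (f (a, x) + M)%:E) - M).
  apply/funext => a; rewrite -[fine _]/(Ex m (fun x => f (a, x) + M)).
  have -> : (fun x => f (a, x) + M) = (fun x => 1 * f (a, x) + cst M x).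
    by apply/funext => x; rewrite mul1r.
  by rewrite Ex_lin//; [rewrite Ex_cst mul1r addrK|exact: bmfun_cst].
apply: measurable_funB; last exact: measurable_cst.
apply: measurableT_comp => //.
apply: (measurable_fun_fubini_tonelli_F (m2 := m) (fun z : A * T => (f z + M)%:E)).
  by apply/measurable_EFinP; apply: measurable_funD => //; exact: measurable_cst.
move=> z; rewrite lee_fin -lerBlDr sub0r.
by have := fM z; rewrite ler_norml => /andP[].
Qed.

Lemma mean_Ex_on (S : set T) : measurable S -> m (~` S)%classic = 0%E ->
  mean_on S (Ex m).
Proof.
move=> mS S0; split=> // f g bf bg fg.
have [_ [M fM]] := bf; have [_ [M' gM]] := bg.
have bC := bmfun_Ex (measurableC mS).
(* Adding [M + M'] on the null set outside [S] leaves the integral of [g] unchanged and makes the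
   comparison with [f] hold everywhere. *)
have <- : Ex m (fun x => (M + M') * \1_(~` S)%classic x + g x) = Ex m g.
  rewrite Ex_lin// [X in _ * X](_ : _ = 0) ?mulr0 ?add0r//.
  rewrite /Ex /Rintegral integral_indic ?setIT//; last exact: measurableC.
  by move: S0 => /= ->.
apply: le_Rintegral => //; [exact: bmfun_integrable| |move=> x _].
  apply: bmfun_integrable; apply: bmfunD => //.
  by apply: bmfunM => //; exact: bmfun_cst.
rewrite indicE; have [Sx|nSx] := pselect (S x).
  by rewrite memNset ?mulr0 ?add0r; [exact: fg|move=> /(_ Sx)].
rewrite mem_set// mulr1.
have := fM x; have := gM x; rewrite !ler_norml; lra.
Qed.

Lemma mean_Ex : mean_on (fun=> True) (Ex m).
Proof.
rewrite (_ : (fun=> True) = [set: T]%classic); last by [].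
by apply: mean_Ex_on => //; rewrite setCT measure0.
Qed.

End MeanProbability.

(** The support is recorded because the bounds on the perturbations hold only almost surely. The
    complement of [[0, u]] is null since the density vanishes there. *)
Lemma mean_Eunif {R : realType} (u : R) (hu : 0 < u) :
  mean_on (fun z : R => 0 <= z <= u) (Eunif hu).
Proof.
have -> : (fun z : R => is_true (0 <= z <= u)) = `[0, u]%classic.
  by apply/seteqP; split => z; rewrite /= in_itv.
(* [uniform_prob] lives on the copy [measurableTypeR R] of [R], which has the
   same measurable sets. *)
suff [] : mean_on (T := measurableTypeR R) `[0, u]%classic (Eunif hu) by [].
apply: (mean_Ex_on (m := uniform_prob hu)).
  exact: measurable_itv.
apply: etrans (integral_uniform_pdf _ _ _) _.
by rewrite setICl integral_set0.
Qed.

Lemma mean_Ezeta {R : realType} (K : nat) (u : R) (hu : 0 < u) :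
  mean_on (fun z : K.-tuple R => forall i, 0 <= tnth z i <= u) (Ezeta hu).
Proof. exact: (mean_iidE K (mean_Eunif hu)). Qed.

Lemma mean_Eunl {R : realType} (d K : nat) (u : R) (hu : 0 < u)
    (mu : probability (d.-tuple R * bool)%type R) :
  mean_on (fun w : (d.-tuple R * bool) * K.-tuple R =>
             True /\ forall i, 0 <= tnth w.2 i <= u) (Eunl hu mu).
Proof. exact: mean_nested (mean_Ex mu) (mean_Ezeta K hu). Qed.

(** A labeled draw is a mixture with weights [p xs k]: their nonnegativity gives monotonicity, and
    their sum being 1 preserves constants. *)
Lemma mean_EPobs {R : realType} (d K : nat)
    (mu : probability (d.-tuple R * bool)%type R)
    (p : d.-tuple R * bool -> 'I_K -> R) :
  (forall k, measurable_fun setT (fun xs => p xs k)) ->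
  (forall xs k, 0 <= p xs k) -> (forall xs, \sum_(k < K) p xs k = 1) ->
  mean_on (fun=> True) (EPobs mu p).
Proof.
move=> mp p0 p1; have mE := mean_Ex mu.
have bp k : bmfun (fun xs => p xs k).
  split=> //; exists 1 => xs; rewrite ger0_norm//.
  by rewrite -(p1 xs) (bigD1 k)//= lerDl sumr_ge0.
have bpf (f : (d.-tuple R * bool) * nat -> R) k : bmfun f ->
    bmfun (fun xs => p xs k * f (xs, val k)).
  by move=> bf; apply: bmfunM => //; exact: (bmfun_comp (pair2_measurable _) bf).
split=> [a f g bf bg|c|f g bf bg fg|d' A f bf].
- rewrite -(mean_lin mE); [|by apply: bmfun_sum => k; exact: bpf..].
  congr Ex; apply/funext => xs; rewrite mulr_sumr -big_split/=.
  by apply: eq_bigr => k _; ring.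
- rewrite -[RHS](mean_cst mE); congr Ex; apply/funext => xs.
  by rewrite -mulr_suml p1 mul1r.
- apply: (mean_le mE); [by apply: bmfun_sum => k; exact: bpf..|move=> xs _].
  by apply: ler_sum => k _; rewrite ler_wpM2l// fg.
- apply: (mean_param mE (f := fun z => \sum_(k < K) p z.2 k * f (z.1, (z.2, val k)))).
  apply: bmfun_sum => k; apply: bmfunM.
    exact: (bmfun_comp measurable_snd (bp k)).
  apply: (bmfun_comp _ bf).
  by repeat apply: measurable_fun_pair.
Qed.

(** * Argmax and its measurability *)

Section Argmax.
Context {R : realType} {K : nat} (k0 : 'I_K).
Implicit Types F : 'I_K -> R.

Lemma argmaxK_ge F k : F k <= F (argmaxK k0 F).
Proof. by rewrite /argmaxK; case: arg_maxP => // i _ /(_ k isT). Qed.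

Lemma maxKE F : maxK k0 F = F (argmaxK k0 F).
Proof.
apply/le_anti/andP; split; last exact: le_bigmax.
by apply/bigmax_leP; split => [|k _]; exact: argmaxK_ge.
Qed.

(** The argmax, including its tie-breaking, is a function of this finite table of comparisons
    alone. *)
Let cmp F : {ffun 'I_K * 'I_K -> bool} := [ffun ij => F ij.2 <= F ij.1].

Let argmaxK_cmp F : argmaxK k0 F =
  odflt k0 [pick i | true && [forall j, true ==> cmp F (i, j)]].
Proof.
rewrite /argmaxK /Order.arg_max /extremum; congr odflt; apply: eq_pick => i /=.
by apply: eq_forallb => j; rewrite ffunE.
Qed.

(** Only finitely many comparison tables exist, and prescribing one is a finite intersection of
    measurable events; the event is the union over the tables whose argmax is [k]. *)
Lemma measurable_argmaxK_eq d (T : measurableType d) (F : T -> 'I_K -> R) k :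
  (forall i, measurable_fun setT (fun x => F x i)) ->
  measurable_fun setT (fun x => argmaxK k0 (F x) == k).
Proof.
move=> mF.
pose B c := [set x | forall ij, cmp (F x) ij = c ij]%classic.
have mB c : measurable (B c).
  rewrite (_ : B c = \bigcap_(ij in [set: 'I_K * 'I_K])
      [set x | cmp (F x) ij = c ij])%classic; last first.
    by apply/seteqP; split => [x Bx ij _|x Bx ij]; exact: Bx.
  apply: fin_bigcap_measurable => // ij _.
  rewrite (_ : [set x | _]%classic =
      [set: T] `&` (fun x => F x ij.2 <= F x ij.1) @^-1` [set c ij])%classic.
    exact: (measurable_fun_ler (mF ij.2) (mF ij.1) measurableT).
  by rewrite setTI; apply/seteqP; split => x /=; rewrite ffunE.
apply: (measurable_fun_bool true) => //=; rewrite setTI.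
rewrite (_ : _ @^-1` _ = \bigcup_(c in
    [set c : {ffun 'I_K * 'I_K -> bool} |
     odflt k0 [pick i | true && [forall j, true ==> c (i, j)]] = k]) B c)%classic.
  by apply: fin_bigcup_measurable => //; exact: finite_finset.
apply/seteqP; split => x /=.
  by move=> /eqP; rewrite argmaxK_cmp => kx; exists (cmp (F x)).
by move=> [c /= ck Bc]; rewrite argmaxK_cmp (_ : cmp (F x) = c) ?ck ?eqxx//; exact/ffunP.
Qed.

End Argmax.

(** Evaluation at a data-dependent class becomes a finite sum of indicators, to which measurability
    and linearity apply. *)
Lemma select_sum {R : realType} (K : nat) (F : 'I_K -> R) (i : 'I_K) :
  F i = \sum_(k < K) (i == k)%:R * F k.
Proof.
rewrite (bigD1 i)//= eqxx mul1r big1 ?addr0// => k /negbTE ki.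
by rewrite eq_sym ki mul0r.
Qed.

Lemma bmfun_select {R : realType} d (T : measurableType d) (K : nat)
    (g : T -> 'I_K) (F : T -> 'I_K -> R) :
  (forall k, measurable_fun setT (fun x => g x == k)) ->
  (forall k, bmfun (fun x => F x k)) -> bmfun (fun x => F x (g x)).
Proof.
move=> mg bF; under eq_fun do rewrite select_sum.
by apply: bmfun_sum => k; apply: bmfunM => //; exact: bmfun_bool.
Qed.

(** Two approximations of the pair [x1], [x2], ordered in opposite ways, bound its difference from
    both sides. They will come from moving [lamstar] forwards and backwards. *)
Lemma dist_sandwich {R : realDomainType} (a1 a2 b1 b2 x1 x2 h1 h2 : R) :
  a1 <= a2 -> b2 <= b1 -> `|a1 - x1| <= h1 -> `|a2 - x2| <= h2 ->
  `|b1 - x1| <= h1 -> `|b2 - x2| <= h2 -> `|x1 - x2| <= h1 + h2.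
Proof. rewrite !ler_norml; lra. Qed.

Lemma measurable_from_bool d (T : measurableType d) (f : bool -> T) :
  measurable_fun setT f.
Proof. by []. Qed.

(** * Fair-risk as an expected score, and exact fairness of the optimal classifier *)

Section Classifiers.
Context {R : realType} {d K : nat}.
Local Notation X := (d.-tuple R).
Local Notation XS := (d.-tuple R * bool)%type.
Context (mu : probability XS R) (p : XS -> 'I_K -> R) (k0 : 'I_K).
Hypothesis hp_meas : forall k, measurable_fun setT (fun xs => p xs k).
Hypothesis hp_ge0 : forall xs k, 0 <= p xs k.
Hypothesis hp_sum : forall xs, \sum_(k < K) p xs k = 1.
Hypothesis hpi : forall s, 0 < pis mu s.
Implicit Types (g : X -> bool -> 'I_K) (lam : 'I_K -> R).

Let mE := mean_Ex mu.

Lemma posterior_le1 xs k : p xs k <= 1.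
Proof. by rewrite -(hp_sum xs) (bigD1 k)//= lerDl sumr_ge0. Qed.

Lemma bmfun_posterior k : bmfun (fun xs => p xs k).
Proof.
split=> //; exists 1 => xs.
by rewrite ger0_norm ?posterior_le1.
Qed.

Lemma measurable_sensitive s : measurable_fun setT (fun xs : XS => xs.2 == s).
Proof.
exact: (measurableT_comp (measurable_from_bool (fun b => b == s)) measurable_snd).
Qed.

Lemma bmfun_of_bool (f : bool -> R) : bmfun (fun xs : XS => f xs.2).
Proof.
split; first exact: (measurableT_comp (measurable_from_bool f)).
exists (`|f true| + `|f false|) => -[x []] /=; first by rewrite lerDl.
by rewrite lerDr.
Qed.

(** The parameter will carry the samples and the perturbations; measurability is joint with [(X,S)],
    so that group probabilities can then be averaged over the parameter. *)
Definition measurable_classifier d' (A : measurableType d')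
    (g : A -> X -> bool -> 'I_K) : Prop :=
  forall k, measurable_fun setT (fun w : A * XS => g w.1 w.2.1 w.2.2 == k).

Definition measurable_class g : Prop :=
  forall k, measurable_fun setT (fun xs : XS => g xs.1 xs.2 == k).

Lemma measurable_classifier_sec d' (A : measurableType d')
    (g : A -> X -> bool -> 'I_K) a :
  measurable_classifier g -> measurable_class (g a).
Proof. by move=> mg k; exact: (measurableT_comp (mg k) (pair1_measurable a)). Qed.

Lemma bmfun_predP d' (A : measurableType d') (g : A -> X -> bool -> 'I_K) k s :
  measurable_classifier g -> bmfun (fun a => predP mu (g a) k s).
Proof.
move=> mg; apply: bmfunM; last exact: bmfun_cst.
apply: (bmfun_mean mE (f := fun a xs => ((g a xs.1 xs.2 == k) && (xs.2 == s))%:R)).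
apply: bmfun_bool; apply: measurable_and => //.
exact: (measurableT_comp (measurable_sensitive s) measurable_snd).
Qed.

Lemma bmfun_risk d' (A : measurableType d') (g : A -> X -> bool -> 'I_K) :
  measurable_classifier g -> bmfun (fun a => risk mu p (g a)).
Proof.
move=> mg.
apply: (bmfun_mean mE (f := fun a xs => \sum_(k < K) p xs k * (g a xs.1 xs.2 != k)%:R)).
apply: bmfun_sum => k; apply: bmfunM.
  exact: (bmfun_comp measurable_snd (bmfun_posterior k)).
by apply: bmfun_bool; apply: measurable_neg.
Qed.

(** The sign [sgn R xs.2] encodes the difference between the groups, and the division by
    [pis mu xs.2] encodes the conditioning. *)
Lemma predP_sum lam g : measurable_class g ->
  \sum_(k < K) lam k * (predP mu g k true - predP mu g k false) =
  Ex mu (fun xs => sgn R xs.2 * lam (g xs.1 xs.2) / pis mu xs.2).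
Proof.
move=> mg.
pose B k s (xs : XS) : R := ((g xs.1 xs.2 == k) && (xs.2 == s))%:R.
have bB k s : bmfun (B k s).
  apply: bmfun_bool; apply: measurable_and => //.
  exact: measurable_sensitive.
have bZ c k s : bmfun (fun xs => c * B k s xs).
  by apply: bmfunM => //; exact: bmfun_cst.
transitivity (\sum_(k < K) Ex mu (fun xs =>
    lam k / pis mu true * B k true xs - lam k / pis mu false * B k false xs)).
  apply: eq_bigr => k _; rewrite (meanB mE)// !(meanZ mE)//.
  by rewrite /predP -!/(B k _); ring.
rewrite -(mean_sum mE); last by move=> k; exact: bmfunB.
congr Ex; apply/funext => -[x s] /=.
rewrite (select_sum lam) mulr_sumr mulr_suml; apply: eq_bigr => k _.
by rewrite /B /=; case: s; rewrite ?andbT ?andbF /=; ring.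
Qed.

Lemma sum_predP g s : measurable_class g -> \sum_(k < K) predP mu g k s = 1.
Proof.
move=> mg; rewrite -mulr_suml -(mean_sum mE); last first.
  move=> k; apply: bmfun_bool; apply: measurable_and => //.
  exact: measurable_sensitive.
have -> : (fun xs : XS => \sum_(k < K) ((g xs.1 xs.2 == k) && (xs.2 == s))%:R) =
    (fun xs => (xs.2 == s)%:R) :> (XS -> R).
  apply/funext => xs.
  rewrite [RHS](select_sum (fun=> (xs.2 == s)%:R : R) (g xs.1 xs.2)).
  by apply: eq_bigr => k _; rewrite -natrM mulnb.
rewrite Ex_bool.
  rewrite (_ : [set x | x.2 == s]%classic = [set xs | xs.2 = s]%classic).
    by rewrite -[fine _]/(pis mu s) divff// gt_eqF//; exact: hpi.
  by apply/seteqP; split => x /= /eqP.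
exact: measurable_sensitive.
Qed.

(** The $h_k$ of the overview. Dividing it by [pis mu xs.2] turns a single integral over [mu] into
    the sum of the two group-conditional expectations. *)
Definition score lam (xs : XS) (k : 'I_K) : R :=
  pis mu xs.2 * p xs k - sgn R xs.2 * lam k.

Lemma bmfun_score lam g : measurable_class g ->
  bmfun (fun xs => score lam xs (g xs.1 xs.2) / pis mu xs.2).
Proof.
move=> mg; apply: bmfunM.
  apply: (bmfun_select (F := score lam)) => // k; apply: bmfunB.
    by apply: bmfunM; [exact: bmfun_of_bool|exact: bmfun_posterior].
  by apply: bmfunM; [exact: bmfun_of_bool|exact: bmfun_cst].
exact: (bmfun_of_bool (fun s => (pis mu s)^-1)).
Qed.

(** Given [xs], the error probability is one minus the posterior of the predicted class; the penalty
    is rewritten by [predP_sum]. *)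
Lemma fair_riskE lam g : measurable_class g ->
  fair_risk mu p lam g =
  1 - Ex mu (fun xs => score lam xs (g xs.1 xs.2) / pis mu xs.2).
Proof.
move=> mg; rewrite /fair_risk predP_sum// /risk /EP.
have b1 : bmfun (fun xs => \sum_(k < K) p xs k * (g xs.1 xs.2 != k)%:R).
  apply: bmfun_sum => k; apply: bmfunM; first exact: bmfun_posterior.
  by apply: bmfun_bool; apply: measurable_neg.
have b2 : bmfun (fun xs => sgn R xs.2 * lam (g xs.1 xs.2) / pis mu xs.2).
  apply: bmfunM; last exact: (bmfun_of_bool (fun s => (pis mu s)^-1)).
  apply: bmfunM; first exact: bmfun_of_bool.
  by apply: (bmfun_select (F := fun=> lam)) => // k; exact: bmfun_cst.
rewrite -(meanD mE b1 b2) -[1 in RHS](mean_cst mE) -(meanB mE (bmfun_cst _)); last first.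
  exact: bmfun_score.
congr Ex; apply/funext => xs /=.
have -> : \sum_(k < K) p xs k * (g xs.1 xs.2 != k)%:R = 1 - p xs (g xs.1 xs.2).
  rewrite (select_sum (p xs) (g xs.1 xs.2)) -[X in _ = X - _](hp_sum xs) -sumrB.
  by apply: eq_bigr => k _; case: eqP => _ /=; ring.
by rewrite /score; field; rewrite gt_eqF ?hpi.
Qed.

Lemma measurable_gfair lam : measurable_class (gfair k0 mu p lam).
Proof.
move=> k; apply: measurable_argmaxK_eq => i.
under eq_fun do rewrite -surjective_pairing.
apply: measurable_funB; apply: measurable_funM => //.
- exact: (bmfun_of_bool _).1.
- exact: (bmfun_of_bool _).1.
Qed.

Lemma gfair_score lam xs k :
  score lam xs k <= score lam xs (gfair k0 mu p lam xs.1 xs.2).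
Proof.
case: xs => x s; exact: (argmaxK_ge k0 (fun k => score lam (x, s) k) k).
Qed.

(** The maxima are attained by [gfair], which makes the objective comparable with the expected score
    of any other classifier. *)
Lemma pop_objE lam :
  pop_obj k0 mu p lam =
  Ex mu (fun xs => score lam xs (gfair k0 mu p lam xs.1 xs.2) / pis mu xs.2).
Proof.
rewrite /pop_obj /condE.
pose H s (xs : XS) := (xs.2 == s)%:R *
  maxK k0 (fun k => pis mu s * p (xs.1, s) k - sgn R s * lam k).
have bH s : bmfun (H s).
  apply: bmfunM; first exact: (bmfun_of_bool (fun b => (b == s)%:R)).
  under eq_fun do rewrite maxKE.
  have bF k : bmfun (fun xs : XS => pis mu s * p (xs.1, s) k - sgn R s * lam k).
    apply: bmfunB; last exact: bmfun_cst.
    apply: bmfunM; first exact: bmfun_cst.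
    apply: (bmfun_comp _ (bmfun_posterior k)).
    exact: measurable_fun_pair.
  apply: (bmfun_select (F := fun (xs : XS) k =>
    pis mu s * p (xs.1, s) k - sgn R s * lam k)) => // k.
  by apply: measurable_argmaxK_eq => i; exact: (bF i).1.
transitivity (\sum_(s : bool) Ex mu (fun xs => (pis mu s)^-1 * H s xs)).
  by apply: eq_bigr => s _; rewrite (meanZ mE)// mulrC.
rewrite -(mean_sum mE); last by move=> s; apply: bmfunM => //; exact: bmfun_cst.
congr Ex; apply/funext => -[x s] /=.
rewrite big_bool /H /= !maxKE.
by rewrite /score /gfair; case: s => /=; ring.
Qed.


Hypothesis hcont : continuity_assumption mu p.
Variable lamstar : 'I_K -> R.
Hypothesis hlamstar : forall lam, pop_obj k0 mu p lamstar <= pop_obj k0 mu p lam.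

Let bump t (k : 'I_K) : 'I_K -> R := fun j => lamstar j + t * (j == k)%:R.

Let tie t (k j : 'I_K) xs : bool :=
  `|score lamstar xs k - score lamstar xs j| <= t.

Let measurable_tie t k j : measurable_fun setT (tie t k j).
Proof.
have mS i : measurable_fun setT (fun xs => score lamstar xs i).
  apply: measurable_funB; apply: measurable_funM => //; exact: (bmfun_of_bool _).1.
apply: measurable_fun_ler; last exact: measurable_cst.
by apply: measurableT_comp => //; exact: measurable_funB.
Qed.

(** The moved objective is the expected [lamstar]-score of [g] minus [t] times its gap at [k]. That
    score is at most the objective at [lamstar], which is minimal, so the subtracted term cannot be
    positive. *)
Let predP_bump t k (g := gfair k0 mu p (bump t k)) :
  t * (predP mu g k true - predP mu g k false) <= 0.
Proof.
have mg := measurable_gfair (bump t k).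
have m0 := measurable_gfair lamstar.
have -> : t * (predP mu g k true - predP mu g k false) =
    \sum_(j < K) (t * (j == k)%:R) * (predP mu g j true - predP mu g j false).
  rewrite (bigD1 k)//= eqxx mulr1 big1 ?addr0// => j /negbTE ->.
  by rewrite mulr0 mul0r.
rewrite predP_sum//; set D := Ex mu _.
have bS : bmfun (fun xs => score lamstar xs (g xs.1 xs.2) / pis mu xs.2).
  exact: bmfun_score.
have bD : bmfun (fun xs : XS => sgn R xs.2 *
    (t * (g xs.1 xs.2 == k)%:R) / pis mu xs.2).
  apply: bmfunM; last exact: (bmfun_of_bool (fun s => (pis mu s)^-1)).
  apply: bmfunM; first exact: bmfun_of_bool.
  by apply: bmfunM; [exact: bmfun_cst|exact: bmfun_bool].
have E1 : pop_obj k0 mu p (bump t k) =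
    Ex mu (fun xs => score lamstar xs (g xs.1 xs.2) / pis mu xs.2) - D.
  rewrite pop_objE -(meanB mE bS bD); congr Ex; apply/funext => xs.
  by rewrite /score /bump -/g; ring.
have E2 : Ex mu (fun xs => score lamstar xs (g xs.1 xs.2) / pis mu xs.2) <=
    pop_obj k0 mu p lamstar.
  rewrite pop_objE; apply: (mean_le mE) => // [|xs _]; first exact: bmfun_score.
  by rewrite ler_wpM2r ?invr_ge0 ?gfair_score// ltW ?hpi.
have := hlamstar (bump t k); rewrite E1; lra.
Qed.

(** Only the score of [k] moves, and by at most [|t|]. Hence the prediction of [k] can change only
    where [k] nearly ties with the class that replaces it or that it replaces. *)
Let gfair_bump_close t k xs :
  `|(gfair k0 mu p (bump t k) xs.1 xs.2 == k)%:R -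
    (gfair k0 mu p lamstar xs.1 xs.2 == k)%:R| <=
  \sum_(j < K | j != k) (tie `|t| k j xs)%:R :> R.
Proof.
have sumge j : j != k -> tie `|t| k j xs ->
    1 <= \sum_(j < K | j != k) (tie `|t| k j xs)%:R :> R.
  by move=> jk tj; rewrite (bigD1 j)//= tj lerDl sumr_ge0.
have bumpE j : score (bump t k) xs j =
    score lamstar xs j - sgn R xs.2 * (t * (j == k)%:R).
  by rewrite /score /bump; ring.
have st : - `|t| <= sgn R xs.2 * t <= `|t|.
  by rewrite -ler_norml normrM /sgn; case: xs.2; rewrite ?normrN normr1 mul1r.
have G0 := @gfair_score lamstar xs; have Gt := @gfair_score (bump t k) xs.
set i := gfair k0 mu p (bump t k) _ _ in Gt *.
set j := gfair k0 mu p lamstar _ _ in G0 *.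
have [ik|ik] := eqVneq i k; have [jk|jk] := eqVneq j k.
- by rewrite subrr normr0 sumr_ge0.
- rewrite subr0 normr1; apply: (sumge j) => //.
  have := G0 k; have := Gt j;
  rewrite !bumpE ik eqxx (negbTE jk) /tie ler_norml /= mulr1 !mulr0; lra.
- rewrite sub0r normrN1; apply: (sumge i) => //.
  have := G0 i; have := Gt k;
  rewrite !bumpE jk eqxx (negbTE ik) /tie ler_norml /= mulr1 !mulr0; lra.
- by rewrite subrr normr0 sumr_ge0.
Qed.

Let cdf_diffE k j s y : cdf_diff mu p k j s y =
  Ex mu (fun xs => ((xs.2 == s) && (p xs k - p xs j <= y))%:R) / pis mu s.
Proof.
rewrite Ex_bool.
  congr (fine (mu _) / _); apply/seteqP; split => xs /=.
    by move=> [-> ->]; rewrite eqxx.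
  by move=> /andP[/eqP -> ->].
apply: measurable_and.
  exact: measurable_sensitive.
by apply: measurable_fun_ler; [exact: measurable_funB|exact: measurable_cst].
Qed.

(** In terms of [p xs k - p xs j], a near-tie is a closed interval of radius [t / pis mu s]. A
    difference of distribution functions sees a half-open interval, so the left end is pushed out to
    twice the radius. *)
Let tie_mass k j s t : 0 < t ->
  Ex mu (fun xs => ((xs.2 == s) && tie t k j xs)%:R) / pis mu s <=
  cdf_diff mu p k j s (sgn R s * (lamstar k - lamstar j) / pis mu s + t / pis mu s) -
  cdf_diff mu p k j s (sgn R s * (lamstar k - lamstar j) / pis mu s - 2 * t / pis mu s).
Proof.
move=> t0; rewrite !cdf_diffE -mulrBl ler_wpM2r ?invr_ge0 ?(ltW (hpi _))//.
set c := sgn R s * _ / _.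
have ms := measurable_sensitive s.
have bF y : bmfun (fun xs => ((xs.2 == s) && (p xs k - p xs j <= y))%:R : R).
  apply: bmfun_bool; apply: measurable_and => //.
  by apply: measurable_fun_ler; [exact: measurable_funB|exact: measurable_cst].
rewrite -(meanB mE)//. apply: (mean_le mE) => [| |xs _].
- by apply: bmfun_bool; exact: measurable_and.
- exact: bmfunB.
have [xss|] := eqVneq xs.2 s; last by rewrite /= subrr.
rewrite /= /tie /score xss.
have -> : pis mu s * p xs k - sgn R s * lamstar k -
   (pis mu s * p xs j - sgn R s * lamstar j) =
   pis mu s * (p xs k - p xs j - c).
  by rewrite /c; field; rewrite gt_eqF ?hpi.
rewrite normrM (gtr0_norm (hpi s)) mulrC -ler_pdivlMr ?hpi//.
have tp : 0 < t / pis mu s by rewrite divr_gt0 ?hpi.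
rewrite -mulrA; move: (t / pis mu s) tp => y y0; move: (p xs k - p xs j) => v.
rewrite ler_norml.
case: (lerP v (c + y)) => h1; case: (lerP v (c - 2 * y)) => h2;
  case: (boolP (_ && _)) => h3 //=; try (move: h3; lra); lra.
Qed.

Lemma gfair_exactly_fair k :
  predP mu (gfair k0 mu p lamstar) k true = predP mu (gfair k0 mu p lamstar) k false.
Proof.
pose c j s := sgn R s * (lamstar k - lamstar j) / pis mu s.
(* For [t > 0] this dominates the total mass of near-ties with [k] in group [s]; the continuity
   assumption makes it vanish with [t]. *)
pose h s t := \sum_(j < K | j != k)
  (cdf_diff mu p k j s (c j s + t / pis mu s) -
   cdf_diff mu p k j s (c j s - 2 * t / pis mu s)).
have ms s := measurable_sensitive s.
have close s t : t != 0 -> `|predP mu (gfair k0 mu p (bump t k)) k s -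
    predP mu (gfair k0 mu p lamstar) k s| <= h s `|t|.
  move=> t0.
  have bP lam : bmfun (fun xs =>
      ((gfair k0 mu p lam xs.1 xs.2 == k) && (xs.2 == s))%:R : R).
    by apply: bmfun_bool; apply: measurable_and => //; exact: measurable_gfair.
  have bN j : bmfun (fun xs => ((xs.2 == s) && tie `|t| k j xs)%:R : R).
    by apply: bmfun_bool; exact: measurable_and.
  have normE (f : XS -> R) : bmfun f -> `|Ex mu f| <= Ex mu (fun xs => `|f xs|).
    move=> bf; rewrite ler_norml; apply/andP; split.
      rewrite lerNl -mulN1r -(meanZ mE)//; apply: (mean_le mE) => [||xs _].
      - by apply: bmfunM => //; exact: bmfun_cst.
      - exact: bmfun_norm.
      - by rewrite mulN1r -normrN ler_norm.
    by apply: (mean_le mE) => // [|xs _]; [exact: bmfun_norm|exact: ler_norm].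
  rewrite /predP -mulrBl -(meanB mE)// normrM [X in _ * X]gtr0_norm ?invr_gt0 ?hpi//.
  apply: (@le_trans _ _ (\sum_(j < K | j != k)
      Ex mu (fun xs => ((xs.2 == s) && tie `|t| k j xs)%:R) / pis mu s)).
    rewrite -mulr_suml ler_wpM2r ?invr_ge0 ?(ltW (hpi _))// -(mean_sum mE)//.
    apply: le_trans (normE _ (bmfunB (bP _) (bP _))) _.
    apply: (mean_le mE) => [||xs _].
    - by apply: bmfun_norm; exact: bmfunB.
    - exact: bmfun_sum.
    have [xss|_] := eqVneq xs.2 s.
      under eq_bigr do rewrite /=.
      by rewrite !andbT; exact: gfair_bump_close.
    by rewrite !andbF subrr normr0 sumr_ge0.
  by apply: ler_sum => j _; apply: tie_mass; rewrite normr_gt0.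
have h0 s : (h s t @[t --> (0 : R)%R^'+] --> (0 : R)%R)%classic.
  apply: cvg_at_right_filter.
  rewrite -[X in (_ --> X)%classic](_ : \sum_(j < K | j != k)
    (cdf_diff mu p k j s (c j s) - cdf_diff mu p k j s (c j s)) = 0); last first.
    by apply: big1 => j _; rewrite subrr.
  have affine (a b : R) : ((a + t * b)%R @[t --> (0 : R)%R] --> a)%classic.
    rewrite -[X in (_ --> X)%classic]addr0 -[X in _ + X](mul0r b).
    by apply: cvgD; [exact: cvg_cst|apply: cvgMr_tmp; exact: cvg_id].
  apply: cvg_big => [|j jk]; first exact: add_continuous.
  have F0 : continuous (cdf_diff mu p k j s) by apply: hcont; rewrite eq_sym.
  apply: cvgB.
    exact: (cvg_comp _ _ (affine (c j s) (pis mu s)^-1) (F0 (c j s))).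
  have -> : (fun t => cdf_diff mu p k j s (c j s - 2 * t / pis mu s)) =
      cdf_diff mu p k j s \o (fun t => c j s + t * (- 2 / pis mu s)).
    by apply/funext => t /=; congr cdf_diff; ring.
  exact: (cvg_comp _ _ (affine (c j s) _) (F0 (c j s))).
set D1 := predP _ _ _ true; set D2 := predP _ _ _ false.
have hD : ((h true t + h false t)%R @[t --> (0 : R)%R^'+] --> (0 : R)%R)%classic.
  by rewrite -[X in (_ --> X)%classic]addr0; exact: cvgD.
(* If the two probabilities differed, some [t > 0] would have less near-tie mass than their
   distance. The moves by [t] and [- t] have gaps of opposite signs, and [dist_sandwich] then
   contradicts this choice. *)
apply/eqP; rewrite -subr_eq0 -normr_eq0 eq_le normr_ge0 andbT leNgt; apply/negP => D0.
have [t [t0 ht]] : exists t, 0 < t /\ h true t + h false t < `|D1 - D2|.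
  have [t []] := filter_ex
    (filterI (nbhs_right_gt (0 : R)) (cvgr_lt _ hD _ D0)).
  by exists t.
have tn0 : t != 0 by rewrite gt_eqF.
have Nt0 : - t != 0 by rewrite oppr_eq0.
have := predP_bump t k; rewrite /= pmulr_rle0// subr_le0 => P1.
have := predP_bump (- t) k; rewrite /= mulNr oppr_le0 pmulr_rge0// subr_ge0 => P2.
have C1 s := close s _ tn0; have C2 s := close s _ Nt0.
rewrite (gtr0_norm t0) in C1; rewrite normrN (gtr0_norm t0) in C2.
move: ht; rewrite ltNge => /negP; apply.
exact: (dist_sandwich P1 P2 (C1 _) (C1 _) (C2 _) (C2 _)).
Qed.

End Classifiers.

(** * Excess fair-risk of a deterministic classifier *)

Section Excess.
Context {R : realType} {d K : nat}.
Local Notation X := (d.-tuple R).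
Local Notation XS := (d.-tuple R * bool)%type.
Context (mu : probability XS R) (p : XS -> 'I_K -> R) (k0 : 'I_K).
Hypothesis hp_meas : forall k, measurable_fun setT (fun xs => p xs k).
Hypothesis hp_ge0 : forall xs k, 0 <= p xs k.
Hypothesis hp_sum : forall xs, \sum_(k < K) p xs k = 1.
Hypothesis hpi : forall s, 0 < pis mu s.
Variable lamstar : 'I_K -> R.
Let gstar := gfair k0 mu p lamstar.
Hypothesis gstar_fair : forall k, predP mu gstar k true = predP mu gstar k false.
Implicit Types (g : X -> bool -> 'I_K) (lam : 'I_K -> R).

Let mE := mean_Ex mu.
Let mgstar : measurable_class gstar := measurable_gfair mu k0 hp_meas lamstar.

Let kappa : R := \sum_(s : bool) (pis mu s)^-1.

Let pisV_le s : (pis mu s)^-1 <= kappa.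
Proof.
rewrite /kappa big_bool; case: s; rewrite ?lerDl ?lerDr invr_ge0 ltW//; exact: hpi.
Qed.

Let kappa_ge0 : 0 <= kappa.
Proof. by apply: sumr_ge0 => s _; rewrite invr_ge0 ltW. Qed.

Lemma excess_riskE g : measurable_class g ->
  fair_risk mu p lamstar g - fair_risk mu p lamstar gstar =
  Ex mu (fun xs => (score mu p lamstar xs (gstar xs.1 xs.2) -
                    score mu p lamstar xs (g xs.1 xs.2)) / pis mu xs.2).
Proof.
move=> mg; have bS h (mh : measurable_class h) :=
  bmfun_score mu hp_meas hp_ge0 hp_sum lamstar mh.
rewrite !(fair_riskE hp_meas hp_ge0 hp_sum hpi)// opprB [LHS]addrC addrA subrK.
rewrite -(meanB mE (bS _ mgstar) (bS _ mg)).
by congr Ex; apply/funext => xs; rewrite [RHS]mulrBl.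
Qed.

Let bmfun_excess g : measurable_class g ->
  bmfun (fun xs => (score mu p lamstar xs (gstar xs.1 xs.2) -
                    score mu p lamstar xs (g xs.1 xs.2)) / pis mu xs.2).
Proof.
move=> mg; under eq_fun do rewrite mulrBl.
by apply: bmfunB; apply: bmfun_score.
Qed.

(** A bound free of the data, kept for samples in which a group is absent: two scores differ by at
    most [pis mu s + 2 * L], and [kappa] dominates the inverse of each [pis mu s]. *)
Lemma excess_risk_le g : measurable_class g ->
  fair_risk mu p lamstar g - fair_risk mu p lamstar gstar <=
  1 + 2 * kappa * \sum_(k < K) `|lamstar k|.
Proof.
move=> mg; rewrite excess_riskE//; apply: (mean_le_cst mE) => [|[x s] _ /=].
  exact: bmfun_excess.
set L := \sum_(k < K) _.
have lamle k : - L <= sgn R s * lamstar k <= L.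
  rewrite -ler_norml normrM (_ : `|sgn R s| = 1) ?mul1r.
    by rewrite /L (bigD1 k)//= lerDl sumr_ge0.
  by rewrite /sgn; case: s; rewrite ?normrN normr1.
have L0 : 0 <= L by exact: sumr_ge0.
rewrite ler_pdivrMr ?hpi//.
have piV : 1 <= kappa * pis mu s by rewrite -ler_pdivrMr ?hpi// mul1r.
have LpiV : L <= kappa * pis mu s * L by rewrite -[leLHS]mul1r ler_wpM2r.
set i := gstar x s; set j := g x s.
have := lamle i; have := lamle j; rewrite /score /=.
have pp : pis mu s * p (x, s) i - pis mu s * p (x, s) j <= pis mu s.
  rewrite -mulrBr ler_piMr ?(ltW (hpi _))// lerBlDr.
  by rewrite (le_trans (posterior_le1 hp_ge0 hp_sum _ _))// lerDl.
have -> : (1 + 2 * kappa * L) * pis mu s = pis mu s + 2 * (kappa * pis mu s * L).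
  by ring.
lra.
Qed.

(** The perturbation is frozen at [z], and [a] stands for the empirical frequencies. For the
    estimated scores [g] beats [gstar] pointwise; passing from true to estimated scores costs the
    error once for each of the two classes, whence the factors 2, and leaves the difference of
    multipliers. *)
Lemma excess_risk_plugin (a : bool -> R) (ph : XS -> 'I_K -> R) lamhat
    (z : 'I_K -> R) (u : R) g :
  measurable_class g ->
  (forall k, measurable_fun setT (fun xs => ph xs k)) ->
  (forall xs k, 0 <= ph xs k <= 1) -> (forall s, 0 <= a s <= 1) ->
  (forall k, 0 <= z k <= u) ->
  (forall x s, let F k := a s * (ph (x, s) k + z k) - sgn R s * lamhat k in
     forall k, F k <= F (g x s)) ->
  fair_risk mu p lamstar g - fair_risk mu p lamstar gstar <=
  2 * Ex mu (fun xs => \sum_(k < K) `|ph xs k - p xs k|) +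
  2 * kappa * (\sum_(s : bool) `|a s - pis mu s| + u) +
  \sum_(k < K) (lamstar k - lamhat k) * (predP mu g k true - predP mu g k false).
Proof.
move=> mg mph ph01 a01 z01 gmax.
set c := 2 * kappa * _.
pose del k := lamstar k - lamhat k.
pose S xs := \sum_(k < K) `|ph xs k - p xs k|.
pose V h (xs : XS) := sgn R xs.2 * del (h xs.1 xs.2) / pis mu xs.2.
have bS : bmfun S.
  apply: bmfun_sum => k; apply: bmfun_norm; apply: bmfunB; last exact: bmfun_posterior.
  split=> //; exists 1 => xs; have /andP[h0 h1] := ph01 xs k.
  by rewrite ger0_norm.
have bV h : measurable_class h -> bmfun (V h).
  move=> mh; apply: bmfunM; last exact: (bmfun_of_bool (fun s => (pis mu s)^-1)).
  apply: bmfunM; first exact: bmfun_of_bool.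
  by apply: (bmfun_select (F := fun=> del)) => // k; exact: bmfun_cst.
have bZ : bmfun (fun xs => 2 * S xs) by apply: bmfunM => //; exact: bmfun_cst.
have bc : bmfun (fun xs => 2 * S xs + c) by apply: bmfunD => //; exact: bmfun_cst.
(* Exact fairness of [gstar] enters here: its share of the multiplier term has mean zero and can be
   subtracted freely. *)
have Vstar : Ex mu (V gstar) = 0.
  rewrite -predP_sum//; apply: big1 => k _.
  by rewrite gstar_fair subrr mulr0.
have -> : 2 * Ex mu S + c +
    \sum_(k < K) del k * (predP mu g k true - predP mu g k false) =
    Ex mu (fun xs => 2 * S xs + c + (V g xs - V gstar xs)).
  rewrite (meanD mE bc (bmfunB (bV _ mg) (bV _ mgstar))).
  rewrite (meanB mE (bV _ mg) (bV _ mgstar)) Vstar subr0.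
  rewrite (meanD mE bZ (bmfun_cst c)) (meanZ mE 2 bS) (mean_cst mE).
  by rewrite predP_sum.
rewrite excess_riskE//; apply: (mean_le mE) => [||[x s] _].
- exact: bmfun_excess.
- by apply: bmfunD => //; apply: bmfunB; exact: bV.
rewrite /V /=; set i := gstar x s; set j := g x s.
have pi0 := hpi s.
pose L := `|a s - pis mu s|.
have u0 : 0 <= u by have /andP[+ +] := z01 k0; exact: le_trans.
have Lc : 2 * (L + u) / pis mu s <= c.
  rewrite /c mulrAC; apply: ler_pM.
  - by rewrite divr_ge0// ltW.
  - by rewrite addr_ge0 // /L normr_ge0.
  - by rewrite ler_wpM2l// pisV_le.
  rewrite lerD2r /L big_bool.
  by case: (s); rewrite ?lerDl ?lerDr.
(* Three errors add up: the posterior error weighted by [pis mu s], the frequency error times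
   [ph <= 1], and the perturbation [a s * z k <= u]. *)
have close k : `|pis mu s * p (x, s) k - a s * (ph (x, s) k + z k)| <=
    pis mu s * S (x, s) + L + u.
  have /andP[ph0 ph1] := ph01 (x, s) k; have /andP[a0 a1] := a01 s.
  have /andP[z0 zu] := z01 k.
  have -> : pis mu s * p (x, s) k - a s * (ph (x, s) k + z k) =
    - (pis mu s * (ph (x, s) k - p (x, s) k)) - (a s - pis mu s) * ph (x, s) k -
    a s * z k by ring.
  apply: le_trans (ler_normB _ _) _; apply: lerD; last first.
    by rewrite ger0_norm ?mulr_ge0// (le_trans _ zu)// ler_piMl.
  apply: le_trans (ler_normB _ _) _; apply: lerD.
    rewrite normrN normrM gtr0_norm// ler_wpM2l ?(ltW pi0)//.
    by rewrite /S (bigD1 k)//= lerDl sumr_ge0.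
  by rewrite normrM (ger0_norm ph0) ler_piMr.
have key : score mu p lamstar (x, s) i - score mu p lamstar (x, s) j <=
    2 * (pis mu s * S (x, s) + L + u) + sgn R s * del j - sgn R s * del i.
  have := gmax x s i; have := close i; have := close j.
  rewrite !ler_norml /score /= -/j /del => /andP[h1 _] /andP[_ h2] h3; lra.
apply: le_trans (_ : (2 * (pis mu s * S (x, s) + L + u) +
    sgn R s * del j - sgn R s * del i) / pis mu s <= _).
  by rewrite ler_wpM2r// invr_ge0 ltW.
have -> : (2 * (pis mu s * S (x, s) + L + u) + sgn R s * del j - sgn R s * del i) /
    pis mu s = 2 * S (x, s) + 2 * (L + u) / pis mu s +
    (sgn R s * del j / pis mu s - sgn R s * del i / pis mu s).
  by field; rewrite gt_eqF.
by rewrite lerD2r lerD2l.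
Qed.

End Excess.

(** * Empirical averages and the empirical objective *)

Section Average.
Context {R : realType} (T : eqType) (r : seq T) (P : pred T).
Hypothesis r_gt0 : (0 < count P r)%N.

Let average_cst (c : R) : ((count P r)%:R)^-1 * \sum_(w <- r | P w) c = c.
Proof.
by rewrite big_const_seq iter_addr_0 -[c *+ _]mulr_natl mulKf ?pnatr_eq0 -?lt0n.
Qed.

Lemma average_ge (F : T -> R) c : (forall w, w \in r -> P w -> c <= F w) ->
  c <= ((count P r)%:R)^-1 * \sum_(w <- r | P w) F w.
Proof.
move=> cF; rewrite -[leLHS]average_cst ler_wpM2l ?invr_ge0//.
rewrite big_seq_cond [leRHS]big_seq_cond.
by apply: ler_sum => w /andP[]; exact: cF.
Qed.

Lemma average_le (F : T -> R) c : (forall w, w \in r -> P w -> F w <= c) ->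
  ((count P r)%:R)^-1 * \sum_(w <- r | P w) F w <= c.
Proof.
move=> cF; rewrite -[leRHS]average_cst ler_wpM2l ?invr_ge0//.
rewrite big_seq_cond [leRHS]big_seq_cond.
by apply: ler_sum => w /andP[]; exact: cF.
Qed.

End Average.

Section Empirical.
Context {R : realType} {d K N : nat}.
Local Notation XS := (d.-tuple R * bool)%type.
Implicit Types smp : N.-tuple (XS * K.-tuple R).

Lemma pihat_itv smp s : 0 <= pihat smp s <= 1.
Proof.
have cN : (Ncount smp s <= N)%N by rewrite -[leqRHS](size_tuple smp) count_size.
rewrite /pihat divr_ge0//=; move: (Ncount smp s) cN => c cN.
(* An empty sample has frequency 0, because the inverse of 0 is 0. *)
have [N0|N0] := posnP N; first by rewrite N0 invr0 mulr0.
by rewrite ler_pdivrMr ?ltr0n// mul1r ler_nat.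
Qed.

(* [emp_obj] at [lam] dominates [lam i - lam j] while at [0] it is at most
   [2 (1 + u)]. *)
Lemma emp_minimizer_osc (k0 : 'I_K) (ph : XS -> 'I_K -> R) smp (lam : 'I_K -> R)
    (u : R) i j :
  (forall xs k, 0 <= ph xs k <= 1) ->
  (forall w, w \in smp -> forall k, 0 <= tnth w.2 k <= u) ->
  (forall s, 0 < Ncount smp s)%N ->
  emp_obj k0 ph smp lam <= emp_obj k0 ph smp (fun=> 0) ->
  lam i - lam j <= 2 * (1 + u).
Proof.
move=> ph01 z01 N0 lammin.
have base w s k : w \in smp ->
    0 <= pihat smp s * (ph (w.1.1, s) k + tnth w.2 k) <= 1 + u.
  move=> ws; have /andP[p0 p1] := ph01 (w.1.1, s) k.
  have /andP[z0 zu] := z01 _ ws k; have /andP[a0 a1] := pihat_itv smp s.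
  rewrite mulr_ge0 ?addr_ge0//=; apply: le_trans (lerD p1 zu).
  by rewrite ler_piMl ?addr_ge0.
have base1 w s k : w \in smp ->
    pihat smp s * (ph (w.1.1, s) k + tnth w.2 k) <= 1 + u.
  by move=> /(base w s k) /andP[].
have max_ge (F : 'I_K -> R) k : F k <= maxK k0 F by rewrite maxKE; exact: argmaxK_ge.
apply: (@le_trans _ _ (emp_obj k0 ph smp lam)).
  (* The unpenalized scores are nonnegative, so every maximum is at least [- lam j] in group [true]
     and at least [lam i] in group [false]. *)
  rewrite /emp_obj big_bool/= [leLHS]addrC; apply: lerD; apply: average_ge => [|w ws _].
  - exact: N0.
  - apply: (le_trans _ (max_ge _ j)) => /=.
    by have /andP[+ _] := base w true j ws; rewrite /sgn; lra.
  - exact: N0.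
  - apply: (le_trans _ (max_ge _ i)) => /=.
    by have /andP[+ _] := base w false i ws; rewrite /sgn; lra.
apply: le_trans lammin _; rewrite /emp_obj mulr_natl mulr2n big_bool/=.
apply: lerD; apply: average_le => [|w ws _]; try exact: N0.
  by rewrite maxKE /= mulr0 subr0; exact: base1.
by rewrite maxKE /= mulr0 subr0; exact: base1.
Qed.

Lemma measurable_Ncount s :
  measurable_fun setT (fun smp : N.-tuple (XS * K.-tuple R) => (Ncount smp s)%:R : R).
Proof.
rewrite /Ncount.
have -> : (fun smp : N.-tuple (XS * K.-tuple R) =>
    (count (fun w => w.1.2 == s) smp)%:R : R) =
    (fun smp => \sum_(i < N) ((tnth smp i).1.2 == s)%:R).
  apply/funext => smp; rewrite -sum1_count big_tuple natr_sum.
  by rewrite big_mkcond; apply: eq_bigr => i _; case: eqP.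
apply: measurable_sum => i.
have mb : measurable_fun setT
    (fun smp : N.-tuple (XS * K.-tuple R) => (tnth smp i).1.2 == s).
  apply: (measurableT_comp (measurable_from_bool (fun b => b == s))).
  apply: (measurableT_comp measurable_snd); apply: (measurableT_comp measurable_fst).
  exact: measurable_tnth.
exact: (bmfun_bool mb).1.
Qed.

Lemma bmfun_pihat s :
  bmfun (fun smp : N.-tuple (XS * K.-tuple R) => pihat smp s).
Proof.
split; first by apply: measurable_funM; [exact: measurable_Ncount|exact: measurable_cst].
by exists 1 => smp; have /andP[p0 p1] := pihat_itv smp s; rewrite ger0_norm.
Qed.

End Empirical.

(** The term in [u * V] is reduced to one in [u] by [V <= 1]; the slack [c] makes room for the
    constant of the absent-group case. *)
Lemma excess_const_bound {R : realFieldType} (kappa c n L E T V u x : R) :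
  0 <= kappa -> 0 <= c -> 0 <= n -> 0 <= L -> 0 <= E -> 0 <= T -> 0 <= V ->
  0 <= u -> V <= 1 ->
  x <= 2 * E + 2 * kappa * (T + u) + n * (2 * L + 2 * (1 + u)) * V ->
  x <= (2 + 2 * kappa + c + n * (2 * L + 4)) * (E + T + V + u).
Proof.
move=> k0 c0 n0 L0 E0 T0 V0 u0 V1 xle; apply: (le_trans xle).
have nuV : n * u * V <= n * u by rewrite ler_piMr// mulr_ge0.
have p1 : 0 <= c * (E + T + V + u) by rewrite mulr_ge0// !addr_ge0.
have p2 : 0 <= kappa * (E + V) by rewrite mulr_ge0// addr_ge0.
have p3 : 0 <= n * L * (E + T + u) by rewrite !mulr_ge0// !addr_ge0.
have p4 : 0 <= n * (2 * E + 2 * T + V + u) by rewrite mulr_ge0// !addr_ge0// mulr_ge0.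
lra.
Qed.

Lemma measurable_ghat {R : realType} (d K N : nat) (k0 : 'I_K)
    dA (A : measurableType dA)
    (ph : A -> d.-tuple R * bool -> 'I_K -> R)
    (smp : A -> N.-tuple ((d.-tuple R * bool) * K.-tuple R))
    (lam : A -> 'I_K -> R) (z : A -> K.-tuple R) :
  (forall k, measurable_fun setT (fun w : A * (d.-tuple R * bool) => ph w.1 w.2 k)) ->
  measurable_fun setT smp -> (forall k, measurable_fun setT (fun a => lam a k)) ->
  measurable_fun setT z ->
  measurable_classifier (fun a x s => ghat k0 (ph a) (smp a) (lam a) x s (z a)).
Proof.
move=> mph msmp mlam mz k; apply: measurable_argmaxK_eq => i /=.
have ms : measurable_fun setT (fun w : A * (d.-tuple R * bool) => w.2.2).
  exact: (measurableT_comp measurable_snd measurable_snd).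
apply: measurable_funB; apply: measurable_funM.
- have -> : (fun w : A * (d.-tuple R * bool) => pihat (smp w.1) w.2.2) =
      (fun w => if w.2.2 then pihat (smp w.1) true else pihat (smp w.1) false).
    by apply/funext => w; case: (w.2.2).
  have mpi s : measurable_fun setT
      (fun w : A * (d.-tuple R * bool) => pihat (smp w.1) s).
    apply: (measurableT_comp (bmfun_pihat s).1).
    exact: (measurableT_comp msmp measurable_fst).
  exact: measurable_fun_ifT.
- apply: measurable_funD.
    by under eq_fun do rewrite -surjective_pairing; exact: mph.
  apply: (measurableT_comp (measurable_tnth i)).
  exact: (measurableT_comp mz measurable_fst).
- exact: (measurableT_comp (measurable_from_bool (@sgn R)) ms).
- exact: (measurableT_comp (mlam i) measurable_fst).
Qed.

(** * Randomized classifiers and the bound for fixed data *)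

Section Randomized.
Context {R : realType} {d K : nat}.
Local Notation X := (d.-tuple R).
Local Notation XS := (d.-tuple R * bool)%type.
Context (mu : probability XS R) (p : XS -> 'I_K -> R) (k0 : 'I_K).
Hypothesis hp_meas : forall k, measurable_fun setT (fun xs => p xs k).
Hypothesis hp_ge0 : forall xs k, 0 <= p xs k.
Hypothesis hp_sum : forall xs, \sum_(k < K) p xs k = 1.
Hypothesis hpi : forall s, 0 < pis mu s.
Variables (u : R) (hu : 0 < u).

Let mz := mean_Ezeta K hu.

Lemma bmfun_predPR dA (A : measurableType dA)
    (G : A -> X -> bool -> K.-tuple R -> 'I_K) k s :
  measurable_classifier (fun (w : A * K.-tuple R) x s => G w.1 x s w.2) ->
  bmfun (fun a => predPR hu mu (G a) k s).
Proof.
move=> mG; apply: (bmfun_mean mz (f := fun a z => predP mu (fun x s => G a x s z) k s)).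
exact: bmfun_predP.
Qed.

Lemma bmfun_fair_riskR dA (A : measurableType dA)
    (G : A -> X -> bool -> K.-tuple R -> 'I_K) lam :
  measurable_classifier (fun (w : A * K.-tuple R) x s => G w.1 x s w.2) ->
  bmfun (fun a => fair_riskR hu mu p lam (G a)).
Proof.
move=> mG; apply: bmfunD; last first.
  apply: bmfun_sum => k; apply: bmfunM; first exact: bmfun_cst.
  by apply: bmfunB; exact: bmfun_predPR.
apply: (bmfun_mean mz (f := fun a z => risk mu p (fun x s => G a x s z))).
exact: (bmfun_risk mu hp_meas hp_ge0 hp_sum mG).
Qed.

Lemma bmfun_unfairR dA (A : measurableType dA)
    (G : A -> X -> bool -> K.-tuple R -> 'I_K) :
  measurable_classifier (fun (w : A * K.-tuple R) x s => G w.1 x s w.2) ->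
  bmfun (fun a => unfairR hu mu (G a)).
Proof.
move=> mG; apply: bmfun_bigmax => k; apply: bmfun_norm.
by apply: bmfunB; exact: bmfun_predPR.
Qed.

Section FixedClassifier.
Variable G : X -> bool -> K.-tuple R -> 'I_K.
Hypothesis mG : measurable_classifier (fun z x s => G x s z).

Let mGz z : measurable_class (fun x s => G x s z).
Proof. exact: (measurable_classifier_sec z mG). Qed.

Lemma fair_risk_gap_sum (w : 'I_K -> R) :
  \sum_(k < K) w k * (predPR hu mu G k true - predPR hu mu G k false) =
  Ezeta hu (fun z => \sum_(k < K) w k *
    (predP mu (fun x s => G x s z) k true - predP mu (fun x s => G x s z) k false)).
Proof.
have bP k s := bmfun_predP mu k s mG.
rewrite (mean_sum mz) => [|k]; last first.
  by apply: bmfunM; [exact: bmfun_cst|exact: bmfunB].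
apply: eq_bigr => k _; rewrite (meanZ mz); last exact: bmfunB.
by rewrite (meanB mz).
Qed.

(** Bounds proved for each frozen perturbation thereby carry over to the randomized classifier by
    averaging. *)
Lemma fair_riskR_mean lam :
  fair_riskR hu mu p lam G =
  Ezeta hu (fun z => fair_risk mu p lam (fun x s => G x s z)).
Proof.
rewrite /fair_riskR fair_risk_gap_sum -(meanD mz)//.
- exact: (bmfun_risk mu hp_meas hp_ge0 hp_sum mG).
- apply: bmfun_sum => k; apply: bmfunM; first exact: bmfun_cst.
  by apply: bmfunB; exact: (bmfun_predP mu k _ mG).
Qed.

Lemma bmfun_fair_risk lam :
  bmfun (fun z => fair_risk mu p lam (fun x s => G x s z)).
Proof.
apply: bmfunD; first exact: (bmfun_risk mu hp_meas hp_ge0 hp_sum mG).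
apply: bmfun_sum => k; apply: bmfunM; first exact: bmfun_cst.
by apply: bmfunB; exact: (bmfun_predP mu k _ mG).
Qed.

Let predP_itv z k s : 0 <= predP mu (fun x s => G x s z) k s <= 1.
Proof.
have p0 i : 0 <= predP mu (fun x s => G x s z) i s.
  rewrite divr_ge0 ?(ltW (hpi s))//.
  apply: (mean_ge (mean_Ex mu)) => //; apply: bmfun_bool; apply: measurable_and.
    exact: mGz.
  exact: measurable_sensitive.
rewrite p0 -(sum_predP hpi s (mGz z)) (bigD1 k)//= lerDl sumr_ge0//.
Qed.

Lemma unfairR_ge0 : 0 <= unfairR hu mu G.
Proof. exact: bigmax_ge_id. Qed.

Lemma unfairR_ge k :
  `|predPR hu mu G k true - predPR hu mu G k false| <= unfairR hu mu G.
Proof. exact: le_bigmax. Qed.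

Lemma unfairR_le1 : unfairR hu mu G <= 1.
Proof.
have pR k s : 0 <= predPR hu mu G k s <= 1.
  have bP := bmfun_predP mu k s mG.
  by rewrite (mean_ge mz)// ?(mean_le_cst mz)// => z _; have /andP[] := predP_itv z k s.
apply/bigmax_leP; split => // k _.
have /andP[? ?] := pR k true; have /andP[? ?] := pR k false.
by rewrite ler_norml; apply/andP; split; lra.
Qed.

(* The gaps sum to 0, so only the oscillation of the weights matters. *)
Lemma weighted_gap_le (w : 'I_K -> R) (M : R) :
  (forall i j, w i - w j <= M) ->
  \sum_(k < K) w k * (predPR hu mu G k true - predPR hu mu G k false) <=
  K%:R * M * unfairR hu mu G.
Proof.
move=> wM; set V := unfairR hu mu G.
pose D k := predPR hu mu G k true - predPR hu mu G k false.
have D0 : \sum_(k < K) w k0 * D k = 0.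
  rewrite fair_risk_gap_sum -[RHS](mean_cst mz); congr Ezeta; apply/funext => z.
  by rewrite -mulr_sumr sumrB !sum_predP// subrr mulr0.
rewrite -[leLHS]subr0 -[X in _ - X <= _]D0 -sumrB -mulrA mulr_natl.
rewrite -[K in leRHS]card_ord -sumr_const.
apply: ler_sum => k _; rewrite -mulrBl.
apply: le_trans (ler_norm _) _; rewrite normrM ler_pM//; last exact: unfairR_ge.
rewrite ler_norml wM andbT lerNl opprB; exact: wM.
Qed.

End FixedClassifier.

Variable lamstar : 'I_K -> R.
Let gstar := gfair k0 mu p lamstar.
Hypothesis gstar_fair : forall k, predP mu gstar k true = predP mu gstar k false.

(** The summands pay in turn for the posterior error, for the frequencies and [u], for samples with
    an absent group, and for the unfairness, where [2 * L + 4] covers the oscillation of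
    [lamstar - lamhat]. *)
Definition excess_const : R :=
  let kappa := \sum_(s : bool) (pis mu s)^-1 in
  let L := \sum_(k < K) `|lamstar k| in
  2 + 2 * kappa + kappa * (1 + 2 * kappa * L) + K%:R * (2 * L + 4).

(** With both groups present, the plug-in bound holds for every perturbation in the support, and
    averaging turns its last term into weighted gaps. With a group absent the multipliers are
    uncontrolled, and [excess_risk_le] takes over. *)
Lemma fair_riskR_ghat_le N (smp : N.-tuple (XS * K.-tuple R))
    (ph : XS -> 'I_K -> R) (lam : 'I_K -> R) (G := ghat k0 ph smp lam) :
  (forall k, measurable_fun setT (fun xs => ph xs k)) ->
  (forall xs k, 0 <= ph xs k <= 1) ->
  (forall w, w \in smp -> forall k, 0 <= tnth w.2 k <= u) ->
  ((0 < Ncount smp true)%N -> (0 < Ncount smp false)%N ->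
    emp_obj k0 ph smp lam <= emp_obj k0 ph smp (fun=> 0)) ->
  fair_riskR hu mu p lamstar G - fair_risk mu p lamstar gstar <=
  excess_const * (Ex mu (fun xs => \sum_(k < K) `|ph xs k - p xs k|) +
    \sum_(s : bool) `|pihat smp s - pis mu s| + unfairR hu mu G + u).
Proof.
move=> mph ph01 z01 lammin.
rewrite /excess_const.
set kappa := \sum_(s : bool) (pis mu s)^-1; set L := \sum_(k < K) `|lamstar k|.
set Ep := Ex mu _; set T := \sum_(s : bool) _; set V := unfairR hu mu G.
have mG : measurable_classifier (fun z x s => G x s z).
  apply: (measurable_ghat (A := K.-tuple R) k0 (ph := fun=> ph) (smp := fun=> smp)
    (lam := fun=> lam)) => // k.
  exact: (measurableT_comp (mph k) measurable_snd).
have mGz z : measurable_class (fun x s => G x s z).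
  exact: (measurable_classifier_sec z mG).
have kappa0 : 0 <= kappa by apply: sumr_ge0 => s _; rewrite invr_ge0 ltW.
have L0 : 0 <= L by exact: sumr_ge0.
have KL0 : 0 <= K%:R * (2 * L + 4) by rewrite mulr_ge0// addr_ge0// mulr_ge0.
have kL0 : 0 <= kappa * (1 + 2 * kappa * L).
  by rewrite mulr_ge0// addr_ge0// !mulr_ge0.
have T0 : 0 <= T by exact: sumr_ge0.
have V0 : 0 <= V by exact: unfairR_ge0.
have V1 : V <= 1 by exact: unfairR_le1.
have Ep0 : 0 <= Ep.
  apply: (mean_ge (mean_Ex mu)) => [|xs _]; last exact: sumr_ge0.
  apply: bmfun_sum => k; apply: bmfun_norm; apply: bmfunB; last exact: bmfun_posterior.
  split=> //; exists 1 => xs; have /andP[h0 h1] := ph01 xs k.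
  by rewrite ger0_norm.
rewrite (fair_riskR_mean mG) -(mean_cst mz (fair_risk mu p lamstar gstar)).
rewrite -(meanB mz (bmfun_fair_risk mG _) (bmfun_cst _)).
have bX : bmfun (fun z => fair_risk mu p lamstar (fun x s => G x s z) -
    fair_risk mu p lamstar gstar).
  by apply: bmfunB; [exact: bmfun_fair_risk|exact: bmfun_cst].
have [N0|[s Ns0]] : (forall s, 0 < Ncount smp s)%N \/ exists s, Ncount smp s = 0%N.
  have [nt|t0] := posnP (Ncount smp true); first by right; exists true.
  have [nf|f0] := posnP (Ncount smp false); first by right; exists false.
  by left => -[].
- pose W z := \sum_(k < K) (lamstar k - lam k) *
    (predP mu (fun x s => G x s z) k true - predP mu (fun x s => G x s z) k false).
  have bW : bmfun W.
    apply: bmfun_sum => k; apply: bmfunM; first exact: bmfun_cst.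
    by apply: bmfunB; exact: (bmfun_predP mu k _ mG).
  have step z : (forall i, 0 <= tnth z i <= u) ->
      fair_risk mu p lamstar (fun x s => G x s z) - fair_risk mu p lamstar gstar <=
      2 * Ep + 2 * kappa * (T + u) + W z.
    move=> zu; apply: (excess_risk_plugin hp_meas hp_ge0 hp_sum hpi gstar_fair
      (a := pihat smp) (z := tnth z)) => // [s|x s F k]; first exact: pihat_itv.
    exact: (argmaxK_ge k0 F k).
  apply: le_trans (_ : 2 * Ep + 2 * kappa * (T + u) + Ezeta hu W <= _).
    rewrite -[X in _ <= X + _](mean_cst mz) -(meanD mz (bmfun_cst _) bW).
    apply: (mean_le mz) => //; apply: bmfunD => //; exact: bmfun_cst.
  have osc i j : lam i - lam j <= 2 * (1 + u).
    by apply: (emp_minimizer_osc i j ph01 z01 N0); exact: lammin.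
  have lamL k : - L <= lamstar k <= L.
    by rewrite -ler_norml /L (bigD1 k)//= lerDl sumr_ge0.
  (* The oscillation of [lamstar] is at most [2 * L], and that of [lam] at most [2 * (1 + u)]. *)
  have WV : Ezeta hu W <= K%:R * (2 * L + 2 * (1 + u)) * V.
    rewrite -fair_risk_gap_sum//; apply: weighted_gap_le => // i j.
    have /andP[_ h1] := lamL i; have /andP[h2 _] := lamL j; have h3 := osc j i.
    lra.
  apply: (excess_const_bound (L := L) _ _ _ _ _ _ _ _ V1) => //; first exact: ltW.
  by rewrite (le_trans _ (lerD (lexx _) WV)).
(* The absent group has empirical frequency 0, so [T >= pis mu s] and [kappa * T >= 1]: a constant
   excess can be charged to the frequency error. *)
- have piT : pis mu s <= T.
    rewrite /T (bigD1 s)//= /pihat Ns0 mul0r sub0r normrN ger0_norm ?(ltW (hpi _))//.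
    by rewrite lerDl sumr_ge0.
  have kpi : 1 <= kappa * T.
    apply: (@le_trans _ _ ((pis mu s)^-1 * pis mu s)).
      by rewrite mulVf// gt_eqF.
    rewrite ler_pM ?invr_ge0 ?(ltW (hpi _))//.
    by rewrite /kappa (bigD1 s)//= lerDl sumr_ge0// => i _; rewrite invr_ge0 ltW.
  apply: (@le_trans _ _ (1 + 2 * kappa * L)).
    by apply: (mean_le_cst mz) => // z _; exact: excess_risk_le.
  set b := 1 + 2 * kappa * L.
  have b0 : 0 <= b by rewrite addr_ge0// !mulr_ge0.
  apply: (@le_trans _ _ (kappa * b * T)).
    by rewrite mulrAC -[leLHS]mul1r ler_wpM2r.
  have u0 := ltW hu.
  apply: ler_pM => //; lra.
Qed.

End Randomized.

(** * Integration over both samples *)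

Unset Implicit Arguments.

Local Notation labeled R d n :=
  (n.-tuple ((d.-tuple R * bool) * nat))%type (only parsing).
Local Notation unlabeled R d K N :=
  (N.-tuple ((d.-tuple R * bool) * K.-tuple R))%type (only parsing).

Theorem theorem2 (R : realType) (d K : nat) (hK : (0 < K)%N)
  (mu : probability (d.-tuple R * bool)%type R)
  (p : (d.-tuple R * bool)%type -> 'I_K -> R)
  (hp_meas : forall k : 'I_K, measurable_fun setT (fun xs => p xs k))
  (hp_ge0 : forall xs k, 0 <= p xs k)
  (hp_sum : forall xs, \sum_(k < K) p xs k = 1)
  (hpi : forall s : bool, 0 < pis mu s)
  (hcont : continuity_assumption mu p)
  (lamstar : 'I_K -> R)
  (hlamstar : forall lam : 'I_K -> R,
      pop_obj (Ordinal hK) mu p lamstar <= pop_obj (Ordinal hK) mu p lam) :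
  exists C : R, 0 < C /\
  forall (n N : nat) (u : R) (hu : 0 < u)
    (phat : n.-tuple ((d.-tuple R * bool) * nat)%type ->
            (d.-tuple R * bool)%type -> 'I_K -> R)
    (hphat_meas : forall k : 'I_K,
        measurable_fun setT
          (fun z : (n.-tuple ((d.-tuple R * bool) * nat) * (d.-tuple R * bool))%type =>
             phat z.1 z.2 k))
    (hphat01 : forall D xs k, 0 <= phat D xs k <= 1)
    (lamhat : n.-tuple ((d.-tuple R * bool) * nat)%type ->
              N.-tuple ((d.-tuple R * bool) * K.-tuple R)%type -> 'I_K -> R)
    (hlamhat_meas : forall k : 'I_K,
        measurable_fun setT
          (fun z : (n.-tuple ((d.-tuple R * bool) * nat) *
                    N.-tuple ((d.-tuple R * bool) * K.-tuple R))%type =>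
             lamhat z.1 z.2 k))
    (hlamhat_min : forall D smp,
        (0 < Ncount smp true)%N -> (0 < Ncount smp false)%N ->
        forall lam : 'I_K -> R,
          emp_obj (Ordinal hK) (phat D) smp (lamhat D smp)
            <= emp_obj (Ordinal hK) (phat D) smp lam),
    let ED := @iidE R _ (EPobs mu p) n in
    let EDN := @iidE R _ (Eunl hu mu) N in
    let gh := fun D smp => ghat (Ordinal hK) (phat D) smp (lamhat D smp) in
    ED (fun D => EDN (fun smp => fair_riskR hu mu p lamstar (gh D smp)))
      - fair_risk mu p lamstar (gfair (Ordinal hK) mu p lamstar)
    <= C * ( ED (fun D => Ex mu (fun xs => \sum_(k < K) `|phat D xs k - p xs k|))
           + \sum_(s : bool) EDN (fun smp => `|pihat smp s - pis mu s|)
           + ED (fun D => EDN (fun smp => unfairR hu mu (gh D smp)))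
           + u ).
Proof.
have fair := gfair_exactly_fair hp_meas hp_ge0 hp_sum hpi hcont hlamstar.
set k0 := Ordinal hK in hlamstar fair *.
have C0 : 0 < excess_const mu lamstar.
  rewrite /excess_const; set kappa := \sum_(s : bool) _.
  have kappa0 : 0 <= kappa by apply: sumr_ge0 => s _; rewrite invr_ge0 ltW.
  have L0 : 0 <= \sum_(k < K) `|lamstar k| by exact: sumr_ge0.
  rewrite -2!addrA ltr_pwDl//.
  by rewrite !addr_ge0// ?mulr_ge0// ?addr_ge0// ?mulr_ge0// mulr_ge0.
exists (excess_const mu lamstar); split=> // n N u hu.
move=> phat mphat phat01 lamhat mlamhat lammin.
cbv zeta.
set ED := @iidE R _ (EPobs mu p) n; set EDN := @iidE R _ (Eunl hu mu) N.
pose gh D smp := ghat k0 (phat D) smp (lamhat D smp).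
have mED : mean_on _ ED := mean_iidE n (mean_EPobs mu hp_meas hp_ge0 hp_sum).
have mEDN : mean_on _ EDN := mean_iidE N (mean_Eunl K hu mu).
(* Once both sides are written as [E2] of one integrand, monotonicity reduces the claim to fixed
   data. *)
pose E2 f := ED (fun D => EDN (fun smp => f (D, smp))).
have m2 : mean_on _ E2 := mean_nested mED mEDN.
have mgh : measurable_classifier
    (fun (w : (labeled R d n * unlabeled R d K N) * K.-tuple R) x s =>
        gh w.1.1 w.1.2 x s w.2).
  apply: (measurable_ghat k0
    (ph := fun w : (labeled R d n * unlabeled R d K N) * K.-tuple R => phat w.1.1)
    (smp := fun w => w.1.2) (lam := fun w => lamhat w.1.1 w.1.2) (z := snd)) => //.
  - move=> k; apply: (measurableT_comp (g := fun w => (w.1.1.1, w.2)) (mphat k)).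
    apply: measurable_fun_pair => //.
    apply: (measurableT_comp measurable_fst).
    exact: (measurableT_comp measurable_fst measurable_fst).
  - exact: (measurableT_comp measurable_snd measurable_fst).
  - by move=> k; exact: (measurableT_comp (mlamhat k) measurable_fst).
pose FR (w : labeled R d n * unlabeled R d K N) :=
  fair_riskR hu mu p lamstar (gh w.1 w.2).
pose U (w : labeled R d n * unlabeled R d K N) := unfairR hu mu (gh w.1 w.2).
have bFR : bmfun FR.
  exact: (bmfun_fair_riskR mu hp_meas hp_ge0 hp_sum hu
    (G := fun w => gh w.1 w.2) lamstar mgh).
have bU : bmfun U by exact: (bmfun_unfairR mu hu (G := fun w => gh w.1 w.2) mgh).
pose A D := Ex mu (fun xs => \sum_(k < K) `|phat D xs k - p xs k|).
have bA : bmfun A.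
  apply: (bmfun_mean (mean_Ex mu)
    (f := fun D xs => \sum_(k < K) `|phat D xs k - p xs k|)).
  apply: bmfun_sum => k; apply: bmfun_norm; apply: bmfunB.
    split=> //; exists 1 => w; have /andP[h0 h1] := phat01 w.1 w.2 k.
    by rewrite ger0_norm.
  exact: (bmfun_comp measurable_snd (bmfun_posterior hp_meas hp_ge0 hp_sum k)).
pose B s (smp : N.-tuple ((d.-tuple R * bool) * K.-tuple R)) :=
  `|pihat smp s - pis mu s|.
have bB s : bmfun (B s).
  by apply: bmfun_norm; apply: bmfunB; [exact: bmfun_pihat|exact: bmfun_cst].
set opt := fair_risk _ _ _ _.
have bSB : bmfun (fun smp => \sum_(s : bool) B s smp) by exact: bmfun_sum.
have bA2 : bmfun (fun w : labeled R d n * unlabeled R d K N => A w.1).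
  exact: bmfun_comp measurable_fst bA.
have bSB2 : bmfun (fun w : labeled R d n * unlabeled R d K N =>
    \sum_(s : bool) B s w.2).
  exact: bmfun_comp measurable_snd bSB.
have bAB := bmfunD bA2 bSB2.
have bABU := bmfunD bAB bU.
have bSum := bmfunD bABU (bmfun_cst u).
(* A term in one sample only is constant for the expectation over the other sample. *)
have EA : ED A = E2 (fun w => A w.1).
  by congr ED; apply/funext => D; rewrite -[LHS](mean_cst mEDN).
have EB : \sum_(s : bool) EDN (B s) = E2 (fun w => \sum_(s : bool) B s w.2).
  by rewrite -(mean_sum mEDN)// -[LHS](mean_cst mED).
rewrite -[X in X - opt]/(E2 FR) -[X in X + _ + _ + u]/(ED A) EA.
rewrite -[X in _ + X + _ + u]/(\sum_(s : bool) EDN (B s)) EB -[X in _ + _ + X + u]/(E2 U).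
rewrite -(meanD m2 bA2 bSB2) -(meanD m2 bAB bU).
rewrite -[X in _ * (_ + X)](mean_cst m2) -(meanD m2 bABU (bmfun_cst _)).
rewrite -(meanZ m2 _ bSum) -[X in _ - X](mean_cst m2) -(meanB m2 bFR (bmfun_cst _)).
apply: (mean_le m2).
- by apply: bmfunB => //; exact: bmfun_cst.
- by apply: bmfunM => //; exact: bmfun_cst.
(* The support of the sample law places all recorded perturbations in [[0, u]], as the bound for
   fixed data requires. *)
move=> [D smp] [_ /= supp].
apply: fair_riskR_ghat_le => //.
- move=> k; exact: (measurableT_comp (mphat k) (pair1_measurable D)).
- by move=> w /tnthP[i ->]; have [] := supp i.
- by move=> Nt Nf; exact: lammin.
Qed.
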